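(* Every $\mathbb{Z}$-odometer is Shannon orbit equivalent to the universal $\mathbb{Z}$-odometer.
   Context: Odometers. A supernatural number is a formal product $\prod_p p^{k_p}$ where $p$ ranges over the primes and each $k_p\in\{0,1,2,\dots,\infty\}$. Let $q=\prod_p p^{k_p}$ be a supernatural number having infinitely many prime factors counted with multiplicity (i.e., infinitely many $k_p$ are nonzero or at least one $k_p$ is $\infty$). Take a sequence $\{n_j\}$ of natural numbers such that each prime $p$ occurs exactly $k_p$ times, in total, among the prime factorizations of the $n_j$, and form the inverse limit of the cyclic groups $\mathbb{Z}/(n_1\cdots n_j)\mathbb{Z}$ with connecting maps given by reduction mod $n_1\cdots n_j$. The group $\mathbb{Z}$ acts on this compact group by translation (the generator $1$ acting by adding the image of $1$), continuously and uniquely ergodically; the resulting free ergodic probability-measure-preserving (p.m.p.) action, with respect to the unique invariant Borel probability measure (Haar measure), is the $q$-odometer. Equivalently, it is the action on $\prod_{j=1}^\infty\{0,1,\dots,n_j-1\}$ with the product of uniform probability measures in which the canonical generator of $\mathbb{Z}$ acts by addition of $(1,0,0,\dots)$ with carry over to the right, with $(n_j-1)_{j=1}^\infty$ sent to $(0,0,0,\dots)$. Up to measure conjugacy the choice of the $n_j$ does not matter. The $\mathbb{Z}$-odometers are the $q$-odometers for all such $q$, and the universal odometer is the one with $k_p=\infty$ for every prime $p$. Shannon orbit equivalence. Let $G\curvearrowright(X,\mu)$ and $H\curvearrowright(Y,\nu)$ be free p.m.p. actions of countable groups (here $G=H=\mathbb{Z}$). An orbit equivalence between them is a measure isomorphism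 $\varphi$ from a $G$-invariant conull set $X_0\subseteq X$ to an $H$-invariant conull set $Y_0\subseteq Y$ such that $\varphi(Gx)=H\varphi(x)$ for all $x\in X_0$. Its associated cocycles $\kappa:G\times X\to H$ and $\lambda:H\times Y\to G$ are defined a.e. by $\kappa(g,x)\varphi(x)=\varphi(gx)$ and $\lambda(s,y)\varphi^{-1}(y)=\varphi^{-1}(sy)$ (a.e. unique by freeness). For $g\in G$ one has the countable partition $\{X_{g,s}:s\in H\}$ of $X$ with $X_{g,s}=\{x\in X:\kappa(g,x)=s\}$, and for $s\in H$ the countable partition $\{Y_{s,g}:g\in G\}$ of $Y$ with $Y_{s,g}=\{y\in Y:\lambda(s,y)=g\}$. The Shannon entropy of a countable partition $\mathcal{P}$ of a probability space $(X,\mu)$ is $H(\mathcal{P})=\sum_{A\in\mathcal{P}}-\mu(A)\log\mu(A)$. The cocycle $\kappa$ (respectively $\lambda$) is Shannon if for every $g\in G$ (respectively $s\in H$) the corresponding partition has finite Shannon entropy. If both are Shannon then $\varphi$ is called a Shannon orbit equivalence, and the two actions are Shannon orbit equivalent if such a $\varphi$ exists. *)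

(* Defs.v *)
From HB Require Import structures.
From mathcomp Require Import all_boot all_order all_algebra.
From mathcomp Require Import all_classical all_reals all_analysis.

Set Implicit Arguments.
Unset Strict Implicit.
Unset Printing Implicit Defensive.

Import Order.TTheory GRing.Theory Num.Theory.

Local Open Scope classical_set_scope.
Local Open Scope ring_scope.

(* [q p] is the exponent of the prime p, [None] standing for infinity; the
   values of q at non-primes are irrelevant. *)
Definition supernatural := nat -> option nat.

Definition universal_supernatural : supernatural := fun=> None.

Definition infinitely_many_factors (q : supernatural) : Prop :=
  infinite_set [set p | prime p /\ q p <> Some 0%N] \/
  exists2 p, prime p & q p = None.

(* p occurs exactly k times in total among the prime factorizations of the
   positive integers n 0, n 1, ... *)
Definition occurs_exactly (n : nat -> nat) (p : nat) (k : option nat) : Prop :=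
  match k with
  | Some k => exists J0, forall J, (J0 <= J)%N ->
      (\sum_(j < J) logn p (n j))%N = k
  | None => forall k, exists J, (k <= \sum_(j < J) logn p (n j))%N
  end.

Definition factor_sequence (q : supernatural) (n : nat -> nat) : Prop :=
  (forall j, (0 < n j)%N) /\
  (forall p, prime p -> occurs_exactly n p (q p)).

(* For N > 0 this is 'I_N with its additive group structure Z/NZ; unlike 'Z_N
   it is also correct for N = 1. *)
Notation Zmod N := 'I_N.-1.+1.

Section inverse_limit.
Variable n : nat -> nat.

Definition modulus (j : nat) : nat := (\prod_(i < j.+1) n i)%N.

Definition residues : Type :=
  prod_topology (fun j => discrete_topology (Zmod (modulus j))).
HB.instance Definition _ := Topological.on residues.

Definition residue (x : residues) (j : nat) : Zmod (modulus j) := x j.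

(* The j-th coordinate lives in Z/(n_0 ... n_j)Z and [inZp] is the connecting
   map, reduction modulo n_0 ... n_j. *)
Definition compatible : set residues :=
  [set x : residues | forall j, inZp (residue x j.+1) = residue x j].

Definition odometer_top : Type := set_type compatible.
HB.instance Definition _ := Topological.on odometer_top.

Definition zero_residues : residues := fun=> 0.

Lemma compatible0 : zero_residues \in compatible.
Proof. by apply/mem_set => j; apply/val_inj; rewrite /= mod0n. Qed.

HB.instance Definition _ := isPointed.Build odometer_top
  (exist _ zero_residues compatible0).

(* [inZp 1 *~ g] is the image of the integer g in Z/(n_0 ... n_j)Z. *)
Definition translate_residues (g : int) (x : residues) : residues :=
  fun j => residue x j + inZp 1 *~ g.

End inverse_limit.

(* [odometer_top n] is the inverse limit with the topology induced by the product
   of the discrete topologies; [odometer n] is its Borel measurable space. *)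
Definition odometer (n : nat -> nat) : Type :=
  g_sigma_algebraType (@open (odometer_top n)).
HB.instance Definition _ n := Measurable.on (odometer n).

Lemma inZpD N M (a b : 'I_M.+1) : (N.+1 %| M.+1)%N ->
  inZp (a + b)%R = inZp a + inZp b :> 'I_N.+1.
Proof. by move=> NM; apply/val_inj; rewrite /= modn_dvdm// modnDm. Qed.

Lemma inZpMz N M (a : 'I_M.+1) g : (N.+1 %| M.+1)%N ->
  inZp (a *~ g)%R = inZp a *~ g :> 'I_N.+1.
Proof.
move=> NM; have z : inZp (0%R : 'I_M.+1) = 0 :> 'I_N.+1.
  by apply/val_inj; rewrite /= mod0n.
have nat_case k : inZp (a *+ k)%R = inZp a *+ k :> 'I_N.+1.
  by elim: k => [|k IHk]; rewrite ?mulr0n// !mulrS inZpD// IHk.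
case: g => k; first exact: nat_case.
rewrite !NegzE !mulrNz -!pmulrn; apply/eqP; rewrite -addr_eq0 -nat_case -inZpD//.
by rewrite addNr z.
Qed.

Section translation.
Variable n : nat -> nat.
Hypothesis n_gt0 : forall j, (0 < n j)%N.

Lemma modulus_gt0 j : (0 < modulus n j)%N.
Proof. by rewrite prodn_gt0. Qed.

Lemma modulusS j : modulus n j.+1 = (modulus n j * n j.+1)%N.
Proof. by rewrite /modulus big_ord_recr. Qed.

Lemma translate_compatible g (x : odometer_top n) :
  translate_residues g (val x) \in compatible (n := n).
Proof.
apply/mem_set => j; have /set_mem/(_ j) xj := valP x.
have dvd : ((modulus n j).-1.+1 %| (modulus n j.+1).-1.+1)%N.
  by rewrite !prednK ?modulus_gt0// modulusS dvdn_mulr.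
rewrite /residue /translate_residues inZpD// inZpMz// xj.
by congr (_ + _ *~ _); apply/val_inj; rewrite /= modn_dvdm.
Qed.

Definition translate (g : int) (x : odometer n) : odometer n :=
  exist _ (translate_residues g (val x)) (translate_compatible g x).

Lemma translate0 x : translate 0 x = x.
Proof.
apply/val_inj/functional_extensionality_dep => j /=.
by rewrite /translate_residues mulr0z addr0.
Qed.

Lemma translateD g h x : translate (g + h) x = translate g (translate h x).
Proof.
apply/val_inj/functional_extensionality_dep => j /=.
by rewrite /translate_residues /residue mulrzDr addrA addrAC.
Qed.

Lemma continuous_translate g :
  continuous (translate g : odometer_top n -> odometer_top n).
Proof.
apply: (@continuous_comp_initial _ _ (residues n)) => x.
apply/cvg_sup; first exact/fmap_filter/(nbhs_filter (x : odometer_top n)).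
move=> j; move: x.
apply: (@continuous_comp_initial _ _ (discrete_topology (Zmod (modulus n j)))).
pose f (y : discrete_topology (Zmod (modulus n j))) :
  discrete_topology (Zmod (modulus n j)) := (y : Zmod _) + inZp 1 *~ g.
have cf : continuous f.
  by apply/continuousP => A _; exact: discrete_open.
have cv : continuous (val : odometer_top n -> residues n).
  exact: initial_continuous.
have cp : continuous (fun y : residues n => (y j : discrete_topology _)).
  exact: (@proj_continuous _ (fun j => discrete_topology (Zmod (modulus n j)))).
have cc : continuous ((fun y : residues n => (y j : discrete_topology _)) \o
    (val : odometer_top n -> residues n)).
  move=> x; exact: (@continuous_comp _ _ _ (val : odometer_top n -> residues n)
    (fun y : residues n => (y j : discrete_topology _)) x (@cv x) (@cp _)).
by move=> x; exact: (@continuous_comp _ _ _ _ f x (@cc x) (@cf _)).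
Qed.

Lemma measurable_translate g : measurable_fun setT (translate g).
Proof.
apply: (@measurability _ _ (odometer n) (odometer n) setT (translate g) (@open (odometer_top n))) => //.
move=> _ [A oA <-]; rewrite setTI; apply: sub_sigma_algebra.
by move/continuousP : (@continuous_translate g); exact.
Qed.

Lemma translate_free (q : supernatural) g x :
  infinitely_many_factors q -> (forall p, prime p -> occurs_exactly n p (q p)) ->
  translate g x = x -> g = 0.
Proof.
move=> qinf nq gx; apply/eqP/negPn/negP => g0.
have dvd j : (modulus n j %| `|g|)%N.
  have : inZp 1 *~ g = 0 :> Zmod (modulus n j).
    apply: (@addrI _ (residue (val x) j)); rewrite addr0.
    by rewrite -[in RHS]gx.
  have h k : inZp 1 *+ k = 0 :> Zmod (modulus n j) -> (modulus n j %| k)%N.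
    move=> /(congr1 val); rewrite Zp_mulrn /= prednK ?modulus_gt0// modnMml mul1n.
    by move/eqP.
  case: (g) => k; first by rewrite -pmulrn => /h.
  by rewrite NegzE mulrNz -pmulrn => /eqP; rewrite oppr_eq0 => /eqP/h; rewrite abszN.
have le p J : (\sum_(j < J) logn p (n j) <= logn p `|g|)%N.
  case: J => [|J]; first by rewrite big_ord0.
  suff -> : (\sum_(j < J.+1) logn p (n j) = logn p (modulus n J))%N.
    by apply: dvdn_leq_log; rewrite ?absz_gt0.
  rewrite /modulus; elim: J.+1 => [|k IHk]; first by rewrite !big_ord0 logn1.
  by rewrite !big_ord_recr/= lognM ?IHk ?prodn_gt0.
case: qinf => [|[p pp qp]]; last first.
  have := nq _ pp; rewrite qp => /(_ (logn p `|g|).+1)[J].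
  by move=> /leq_trans/(_ (le p J)); rewrite ltnn.
apply; apply: (@sub_finite_set _ _ [set` primes `|g|]); last exact: finite_seq.
move=> p [pp qp]; rewrite /= -logn_gt0.
have := nq _ pp; case: (q p) qp => [[//|k] _ [J /(_ J (leqnn _)) EJ]|_ /(_ 1%N)[J hJ]].
  by apply: leq_trans (le p J); rewrite EJ.
exact: leq_trans hJ (le p J).
Qed.

End translation.

Definition invariant_measure (R : realType) d (X : measurableType d)
    (mu : probability X R) (a : int -> X -> X) : Prop :=
  forall g A, measurable A -> mu (a g @^-1` A) = mu A.

Record free_pmp_action (R : realType) d (X : measurableType d)
    (mu : probability X R) := FreePmpAction {
  act :> int -> X -> X ;
  act0 : forall x, act 0 x = x ;
  actD : forall g h x, act (g + h) x = act g (act h x) ;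
  measurable_act : forall g, measurable_fun setT (act g) ;
  invariant_act : invariant_measure mu act ;
  free_act : {ae mu, forall x, forall g, act g x = x -> g = 0} }.

(* The translation action of Z is uniquely ergodic: the invariant Borel
   probability measure mu below is necessarily the Haar measure. *)
Section odometer_action.
Variables (R : realType) (q : supernatural) (n : nat -> nat).
Hypothesis qinf : infinitely_many_factors q.
Hypothesis nq : factor_sequence q n.
Variable mu : probability (odometer n) R.
Hypothesis mu_inv : invariant_measure mu (translate nq.1).

Lemma translate_ae_free :
  {ae mu, forall x, forall g, translate nq.1 g x = x -> g = 0}.
Proof. by apply: aeW => x g; exact: translate_free qinf nq.2. Qed.

Definition odometer_action : free_pmp_action mu :=
  FreePmpAction (translate0 nq.1) (translateD nq.1) (measurable_translate nq.1)
    mu_inv translate_ae_free.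

End odometer_action.

Lemma universal_infinitely_many : infinitely_many_factors universal_supernatural.
Proof. by right; exists 2%N. Qed.

Section shannon_orbit_equivalence.
Context (R : realType).

Section entropy.
Context d (X : measurableType d) (mu : probability X R).

(* The pieces of the partition are the sets P i; empty or null pieces contribute
   0 because ln 0 = 0 in the library. *)
Definition entropy (I : choiceType) (P : I -> set X) : \bar R :=
  \esum_(i in [set: I]) (- (fine (mu (P i)) * ln (fine (mu (P i)))))%:E.

End entropy.

(* phi : X0 -> Y0 is the partial isomorphism, extended arbitrarily outside X0;
   psi restricted to Y0 is its inverse. *)
Record orbit_equivalence d1 (X : measurableType d1) d2 (Y : measurableType d2)
    (mu : probability X R) (nu : probability Y R)
    (a : free_pmp_action mu) (b : free_pmp_action nu)
    (X0 : set X) (Y0 : set Y) (phi : X -> Y) (psi : Y -> X) : Prop := {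
  oe_domain : [/\ measurable X0, mu (~` X0) = 0%E
    & forall g, a g @` X0 = X0] ;
  oe_codomain : [/\ measurable Y0, nu (~` Y0) = 0%E
    & forall h, b h @` Y0 = Y0] ;
  oe_bij : set_bij X0 Y0 phi ;
  oe_inverse : {in X0, cancel phi psi} ;
  oe_measurable : measurable_fun X0 phi ;
  oe_measurable_inv : measurable_fun Y0 psi ;
  oe_measure : forall B, measurable B -> mu (X0 `&` phi @^-1` B) = nu B ;
  oe_orbit : forall x, X0 x ->
    phi @` range (a ^~ x) = range (b ^~ (phi x)) }.

Section cocycle.
Context d1 (X : measurableType d1) d2 (Y : measurableType d2)
  (mu : probability X R) (nu : probability Y R)
  (a : free_pmp_action mu) (b : free_pmp_action nu).

(* Since b is free, kappa g is determined almost everywhere by this condition. *)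
Definition cocycle_of (X0 : set X) (phi : X -> Y) (kappa : int -> X -> int) : Prop :=
  forall g x, X0 x -> b (kappa g x) (phi x) = phi (a g x).

Definition cocycle_partition (X0 : set X) (kappa : int -> X -> int) (g s : int)
  : set X := [set x | X0 x /\ kappa g x = s].

Definition shannon_cocycle (X0 : set X) (kappa : int -> X -> int) : Prop :=
  forall g, (forall s, measurable (cocycle_partition X0 kappa g s)) /\
    (entropy mu (cocycle_partition X0 kappa g) < +oo)%E.
End cocycle.

Definition shannon_orbit_equivalent d1 (X : measurableType d1)
    d2 (Y : measurableType d2) (mu : probability X R) (nu : probability Y R)
    (a : free_pmp_action mu) (b : free_pmp_action nu) : Prop :=
  exists (X0 : set X) (Y0 : set Y) (phi : X -> Y) (psi : Y -> X)
    (kappa : int -> X -> int) (lambda : int -> Y -> int),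
    [/\ orbit_equivalence a b X0 Y0 phi psi,
        cocycle_of a b X0 phi kappa, shannon_cocycle mu X0 kappa,
        cocycle_of b a Y0 psi lambda & shannon_cocycle nu Y0 lambda].

End shannon_orbit_equivalence.

(* Main.v *)
Require Import Defs.
From HB Require Import structures.
From mathcomp Require Import all_boot all_order all_algebra.
From mathcomp Require Import all_classical all_reals all_analysis.
From mathcomp Require Import zify ring lra.

(** The two odometers are compared through towers.  A point of an odometer is a
    compatible sequence of residues [x_k < N_k], where [N_0 | N_1 | ...] is any
    chain cofinal with the partial products of its defining sequence, and
    translation adds [g] to every residue.  For the [q]-odometer take partial
    products [N_k] that grow very fast.  For the universal odometer any chain
    in which every integer divides some term will do; so [M_(k+1)] can be chosen
    as the largest multiple of [(k+1) M_k] below [N_(k+1)].  The gap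
    [N_(k+1) - M_(k+1)] is then at most [(k+1) M_k], hence negligible compared
    with [N_(k+1)].

    Stage [k] is a permutation [F_k] of [0, ..., N_k - 1]: level [i] of the
    first tower is matched with level [F_k i] of the second one if
    [F_k i < M_k], and is a gap level otherwise.  At stage [k+1] the first tower
    consists of [a = N_(k+1) / N_k] columns of height [N_k] and the second of
    [b >= a] columns of height [M_k].  Column [c] of the first is glued to
    column [slot c] of the second, so old matches persist; the [b - a] columns
    left over receive gap levels, in increasing order.  The leftover columns are
    spread evenly, so that [F_(k+1)] moves no matched level by more than
    [D_(k+1) = O(k N_k^2)] ([extend_displacement]).

    Two points are linked if their residues are matched at all late stages, and
    this defines the orbit equivalence [partner].  If [x] and [x + g] are both
    linked from stage [k] on and have residues [x_k], [x_k + g] modulo [N_k],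
    their partners differ by the difference of the matched levels, for ever
    ([linked_translate]).  So the cocycle is bounded by [|g| + 2 D_k] there,
    and this covers all but [(2 + |g|) eps_k] of the space, with
    [eps_k = 1 / (2^k sqrt N_k)].  As [log D_(k+1)] is [O(log N_k)], the series
    of the [eps_k log D_(k+1)] converges, the logarithm of the cocycle is
    integrable and its entropy is finite ([entropy_finite]).  It is essential
    that [D_(k+1)] is controlled by [N_k] alone: when the primes in [q] are
    sparse, [log N_(k+1)] is not controlled by [N_k].

    Everything about matched levels is symmetric in the two towers
    ([matching]), so the inverse cocycle is treated by the same lemmas, applied
    to the transposed relation. *)

Set Implicit Arguments.
Unset Strict Implicit.
Unset Printing Implicit Defensive.

Import Order.TTheory GRing.Theory Num.Theory.

(** * Matching the levels of two towers *)

(** New column of the [c]-th old one.  The [c] columns before it contain [c * g]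
    gap levels, which fill [c * g %/ M] whole spare columns; these are placed
    before it, up to the [h] that are needed. *)
Definition slot (g M h c : nat) : nat := c + minn (c * g %/ M) h.

(** New position of the [u]-th spare column.  The number added to [u] is the
    least [c] with [u.+1 * M <= c * g], that is the number of old columns needed
    to provide the gap levels for the spare columns up to this one. *)
Definition spare (g M u : nat) : nat := u + ((u.+1 * M).-1 %/ g).+1.

Section columns.
Variables (g M h : nat).
Hypotheses (g_gt0 : 0 < g) (M_gt0 : 0 < M).

Lemma slot_lt c c' : c < c' -> slot g M h c < slot g M h c'.
Proof.
move=> cc'; have : c * g %/ M <= c' * g %/ M by rewrite leq_div2r ?leq_mul2r
  ?(ltnW cc') ?orbT.
by rewrite /slot; lia.
Qed.

Lemma slot_inj : injective (slot g M h).
Proof.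
move=> c c' e; case: (ltngtP c c') => // /slot_lt; rewrite e ltnn //.
Qed.

Lemma spare_lt u u' : u < u' -> spare g M u < spare g M u'.
Proof.
move=> uu'; suff : (u.+1 * M).-1 %/ g <= (u'.+1 * M).-1 %/ g by rewrite /spare;
  lia.
by apply: leq_div2r; nia.
Qed.

Lemma spare_inj : injective (spare g M).
Proof.
move=> c c' e; case: (ltngtP c c') => // /spare_lt; rewrite e ltnn //.
Qed.

(** A column [c] precedes the [u]-th spare one exactly when [c * g < u.+1 * M];
    comparing the two formulas on each side of this threshold separates them. *)
Lemma slot_neq_spare c u : u < h -> slot g M h c <> spare g M u.
Proof.
move=> uh; rewrite /slot /spare.
have [le|lt] := leqP c ((u.+1 * M).-1 %/ g).
  suff : c * g %/ M <= u by lia.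
  rewrite -ltnS ltn_divLR //.
  have : c * g <= (u.+1 * M).-1 by rewrite -leq_divRL.
  by move: (muln_gt0 u.+1 M); rewrite M_gt0; lia.
suff : u < c * g %/ M by lia.
rewrite leq_divRL //; move: lt; rewrite ltn_divLR //; lia.
Qed.

Lemma spare_bound a u : u < h -> h * M <= a * g -> spare g M u < a + h.
Proof.
move=> uh hM; suff : (u.+1 * M).-1 %/ g < a by rewrite /spare; lia.
rewrite ltn_divLR //; have : u.+1 * M <= h * M by rewrite leq_mul2r uh orbT.
by move: (muln_gt0 u.+1 M); rewrite M_gt0; lia.
Qed.

End columns.

(** One stage of the construction: [F] permutes the levels below [N], and those
    sent to [M] or above are the gap levels.  The [t]-th gap level of the [a]
    columns fills the [t]-th level of the [h] spare columns; once these are full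
    the remaining gap levels are numbered from [(a + h) * M] on. *)
Definition extend (N M a h : nat) (F : nat -> nat) (x : nat) : nat :=
  let c := x %/ N in let j := F (x %% N) in let g := N - M in
  if j < M then slot g M h c * M + j else
  let t := c * g + (j - M) in
  if t < h * M then spare g M (t %/ M) * M + t %% M
  else (a + h) * M + (t - h * M).

Lemma mixed_radix_inj (M a b r s : nat) : r < M -> s < M -> a * M + r = b * M
  + s -> a = b /\ r = s.
Proof.
move=> rM sM e; have M0 : 0 < M by lia.
have := congr1 (divn ^~ M) e; have := congr1 (modn ^~ M) e => /=.
by rewrite !modnMDl !divnMDl // !divn_small // !modn_small // !addn0.
Qed.

Lemma mixed_radix_lt (M a b r : nat) : a < b -> r < M -> a * M + r < b * M.
Proof.
move=> ab rM; have : a.+1 * M <= b * M by rewrite leq_mul2r ab orbT.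
by rewrite mulSn; lia.
Qed.

Section extend.
Variables (N M a h : nat) (F : nat -> nat).
Hypotheses (M_gt0 : 0 < M) (MN : M < N) (hM : h * M <= a * (N - M)).
Hypotheses (F_lt : forall i, i < N -> F i < N).
Hypotheses (F_inj : forall i i', i < N -> i' < N -> F i = F i' -> i = i').

Let E := extend N M a h F.

Lemma extend_old c i : i < N -> F i < M ->
  E (c * N + i) = slot (N - M) M h c * M + F i.
Proof.
move=> iN FiM; have N0 : 0 < N by exact: leq_ltn_trans iN.
by rewrite /E /extend divnMDl // modnMDl (divn_small iN) (modn_small iN) addn0
  FiM.
Qed.

Let aN : a * N = a * M + a * (N - M).
Proof. by rewrite -mulnDr subnKC // ltnW. Qed.

Lemma extend_lt x : x < a * N -> E x < a * N.
Proof.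
move=> xa; have N0 : 0 < N by lia.
have ca : x %/ N < a by rewrite ltn_divLR.
have := F_lt (ltn_pmod x N0); rewrite /E /extend; cbv zeta.
set c := x %/ N in ca *; set j := F _ => jN.
have le : (a + h) * M <= a * N by rewrite aN mulnDl; lia.
case: (ltnP j M) => [jM|Mj].
  by apply: leq_trans le; apply: mixed_radix_lt => //; rewrite /slot; lia.
have g0 : 0 < N - M by lia.
have tlt : c * (N - M) + (j - M) < a * (N - M) by apply: mixed_radix_lt; lia.
set t := c * _ + _ in tlt *.
case: (ltnP t (h * M)) => [tM|tM]; last by rewrite aN mulnDl; lia.
have uh : t %/ M < h by rewrite ltn_divLR.
apply: leq_trans le; apply: mixed_radix_lt; last exact: ltn_pmod.
exact: spare_bound.
Qed.

Lemma extend_inj x x' : x < a * N -> x' < a * N -> E x = E x' -> x = x'.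
Proof.
move=> xa xa'; have N0 : 0 < N by lia.
have g0 : 0 < N - M by lia.
have ca : x %/ N < a by rewrite ltn_divLR.
have ca' : x' %/ N < a by rewrite ltn_divLR.
suff H : E x = E x' -> x %/ N = x' %/ N /\ F (x %% N) = F (x' %% N).
  move=> /H[e1 e2]; rewrite (divn_eq x N) (divn_eq x' N) e1; congr (_ + _).
  by apply: F_inj => //; rewrite ltn_pmod.
have := F_lt (ltn_pmod x N0); have := F_lt (ltn_pmod x' N0).
rewrite /E /extend; cbv zeta.
set c := x %/ N in ca *; set j := F (x %% N).
set c' := x' %/ N in ca' *; set j' := F (x' %% N) => jN' jN.
have slotb d r : d < a -> r < M -> slot (N - M) M h d * M + r < (a + h) * M.
  by move=> da rM; apply: mixed_radix_lt => //; rewrite /slot; lia.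
have spareh t : t < h * M -> t %/ M < h by rewrite ltn_divLR.
have mlt t := ltn_pmod t M_gt0.
have spareb t : t < h * M -> spare (N - M) M (t %/ M) * M + t %% M < (a + h)
  * M.
  by move=> th; apply: mixed_radix_lt => //; apply: spare_bound => //;
    apply: spareh.
case: (ltnP j M) => jM; case: (ltnP j' M) => jM'.
- by move=> /mixed_radix_inj [] // /(slot_inj g0 M_gt0).
- set t := c' * _ + _; case: (ltnP t (h * M)) => tM.
    by move=> /mixed_radix_inj [] // /(slot_neq_spare g0 M_gt0 (spareh _ tM)).
  by have := slotb _ _ ca jM; lia.
- set t := c * _ + _; case: (ltnP t (h * M)) => tM.
    by move=> /mixed_radix_inj [] // /esym
      /(slot_neq_spare g0 M_gt0 (spareh _ tM)).
  by have := slotb _ _ ca' jM'; lia.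
set t := c * _ + _; set t' := c' * _ + _.
have H : t = t' -> c = c' /\ j = j'.
  by move=> /mixed_radix_inj[]; lia.
case: (ltnP t (h * M)) => tM; case: (ltnP t' (h * M)) => tM'.
- move=> /(mixed_radix_inj (mlt t) (mlt t'))[/(spare_inj g0 M_gt0) e1 e2];
    apply: H.
  by rewrite (divn_eq t M) (divn_eq t' M) e1 e2.
- by have := spareb _ tM; lia.
- by have := spareb _ tM'; lia.
- by move=> e; apply: H; lia.
Qed.

(** In an old column [c] the displacement is [c * N - slot c * M], which is less
    than [M] while spare columns are being inserted and at most the final gap
    [a * N - (a + h) * M] afterwards.  A gap level numbered [t] in column [c]
    lies at height about [t + c * M] on both sides: its spare column comes after
    at least [c + 1] and at most [c + M + 2] old ones. *)
Lemma extend_displacement x : x < a * N -> E x < (a + h) * M ->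
  x <= E x + (a * N - (a + h) * M + 4 * N ^ 2) /\
  E x <= x + (a * N - (a + h) * M + 4 * N ^ 2).
Proof.
move=> xa; have N0 : 0 < N by lia.
have g0 : 0 < N - M by lia.
have ca : x %/ N < a by rewrite ltn_divLR.
have := F_lt (ltn_pmod x N0); rewrite /E /extend; cbv zeta.
have xE := divn_eq x N; have := ltn_pmod x N0.
set c := x %/ N in ca xE *; set j := F _; set i := x %% N in xE * => iN jN.
have -> : a * N - (a + h) * M = a * (N - M) - h * M by rewrite aN mulnDl; lia.
have cN : c * N = c * M + c * (N - M) by rewrite -mulnDr subnKC // ltnW.
have N2 : N <= N ^ 2 by rewrite leq_pmulr.
have MN2 : M * M <= N ^ 2 by apply: leq_mul; lia.
rewrite cN in xE; move: (N ^ 2) N2 MN2 => Q N2 MN2.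
case: (ltnP j M) => [jM _|Mj].
  rewrite /slot; case: (leqP (c * (N - M) %/ M) h) => ch.
    have := ltn_pmod (c * (N - M)) M_gt0; have := divn_eq (c * (N - M)) M.
    by rewrite mulnDl; lia.
  have h1 : h.+1 * M <= c * (N - M) by rewrite -leq_divRL.
  have h2 : c * (N - M) <= a * (N - M) by rewrite leq_mul2r (ltnW ca) orbT.
  by rewrite mulnDl; move: h1; rewrite mulSn; lia.
set t := c * _ + _; case: (ltnP t (h * M)) => [tM _|tM]; last by lia.
have e := divn_eq t M; have := ltn_pmod t M_gt0.
rewrite /spare; set u := t %/ M in e *; set r := t %% M in e * => rM.
have := divn_eq (u.+1 * M).-1 (N - M); have := ltn_pmod (u.+1 * M).-1 g0.
set q := _ %/ (N - M); set r' := _ %% _ => r'g; rewrite mulSn => eq.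
have lq : c <= q.
  by rewrite -ltnS -(ltn_pmul2r g0) mulSn; rewrite /t in e; lia.
have uq : q <= c + M.+1.
  rewrite -(leq_pmul2r g0) mulnDl mulSn.
  have : M <= M * (N - M) by rewrite leq_pmulr.
  by rewrite /t in e; lia.
have -> : (u + q.+1) * M + r = t + q.+1 * M by rewrite mulnDl; lia.
have : c * M <= q * M by rewrite leq_mul2r lq orbT.
have : q * M <= (c + M.+1) * M by rewrite leq_mul2r uq orbT.
by rewrite mulnDl !mulSn /t; lia.
Qed.

End extend.

(** What the construction of the orbit equivalence uses of the stages: [R k i j]
    means that levels [i] and [j] are matched at stage [k], and [match_col] says
    that columns are glued rigidly, so that one match between two columns
    entails the others.  The conditions are symmetric in the two towers. *)
Record matching (N M : nat -> nat) (R : nat -> nat -> nat -> Prop)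
  (D : nat -> nat) : Prop :=
  Matching {
  match_lt : forall k i j, R k i j -> i < N k /\ j < M k ;
  match_fun : forall k i j j', R k i j -> R k i j' -> j = j' ;
  match_inj : forall k i i' j, R k i j -> R k i' j -> i = i' ;
  match_col : forall k c c' i i' j j', R k i j -> R k i' j' ->
    R k.+1 (c * N k + i) (c' * M k + j) -> R k.+1 (c * N k + i') (c' * M k + j')
      ;
  match_disp : forall k i j, R k i j -> i <= j + D k /\ j <= i + D k }.

Definition transpose (R : nat -> nat -> nat -> Prop) k i j : Prop := R k j i.

Lemma matching_sym N M R D :
  matching N M R D -> matching M N (transpose R) D.
Proof.
case=> lt fn inj col disp; split.
- by move=> k i j /lt[].
- by move=> k i j j'; exact: inj.
- by move=> k i i' j; exact: fn.
- by move=> k c c' i i' j j'; exact: col.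
- by move=> k i j /disp[].
Qed.

Section towers.
Variable N : nat -> nat.

(** The factor [k'.+1] makes every integer divide some height, and starting from
    [(N k).-1] keeps the gap positive, so that each stage has gap levels to fill
    spare columns with. *)
Fixpoint height (k : nat) : nat :=
  if k is k'.+1 then
    let d := k'.+1 * height k' in (N k).-1 %/ d * d
  else (N 0).-1.

Fixpoint stage_perm (k : nat) : nat -> nat :=
  if k is k'.+1 then
    extend (N k') (height k') (N k %/ N k')
      (height k %/ height k' - N k %/ N k')
      (stage_perm k')
  else id.

Definition matched (k i j : nat) : Prop :=
  [/\ i < N k, j < height k & stage_perm k i = j].

Definition displacement (k : nat) : nat :=
  if k is k'.+1 then (k + 4) * N k' ^ 2 else 0.

Hypothesis N0_ge4 : 4 <= N 0.
Hypothesis N_dvd : forall k, N k %| N k.+1.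
Hypothesis N_growth : forall k, (2 ^ k.+2 * k.+3 * N k) ^ 2 <= N k.+1.

Let M := height.

Lemma N_gt0 k : 0 < N k.
Proof.
elim: k => [|k IH]; first by lia.
by apply: leq_trans (N_growth k); rewrite expn_gt0 !(muln_gt0, expn_gt0) IH.
Qed.

Lemma N_growth_weak k : k.+3 * N k * N k <= N k.+1.
Proof.
apply: leq_trans (N_growth k); rewrite -mulnn -(mulnA (2 ^ k.+2)).
have z0 : 0 < 2 ^ k.+2 by rewrite expn_gt0.
apply: leq_mul; first exact: leq_pmull.
by apply: leq_trans (leq_pmull _ z0); rewrite leq_pmull.
Qed.

Lemma N_ge_index k : k.+4 <= N k.
Proof.
elim: k => [|k IH] //; apply: leq_trans (N_growth_weak k).
have : k.+3 * 1 * k.+4 <= k.+3 * N k * N k by rewrite leq_mul // leq_mul //;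
  lia.
by lia.
Qed.

Lemma height_step k : 0 < M k < N k ->
  [/\ 0 < M k.+1, M k.+1 < N k.+1 & N k.+1 - M k.+1 <= k.+1 * M k].
Proof.
move=> /andP[M0 MN] /=; rewrite /M /= -/M; set d := k.+1 * M k.
have d0 : 0 < d by rewrite muln_gt0.
have dN : d < N k.+1.
  apply: leq_trans (N_growth_weak k); have Nk := N_gt0 k.
  rewrite (leq_trans _ (leq_pmulr _ Nk)) // /d.
  have : k.+1 * M k < k.+3 * N k by apply: ltn_mul.
  by [].
have := ltn_ceil (N k.+1).-1 d0; have := leq_trunc_div (N k.+1).-1 d.
rewrite mulSn; have : 0 < (N k.+1).-1 %/ d by rewrite divn_gt0 //; lia.
case: (_ %/ d) => // q _; rewrite mulSn => le gt; split; lia.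
Qed.

Lemma height_bounds k : 0 < M k < N k.
Proof.
elim: k => [|k /height_step[-> ->]] //.
by have := N0_ge4; rewrite /M /=; lia.
Qed.

Lemma height_dvd k : k.+1 * M k %| M k.+1.
Proof. exact: dvdn_mull. Qed.

Lemma height_dvd_succ k : M k %| M k.+1.
Proof. exact: dvdn_trans (dvdn_mull _ (dvdnn _)) (height_dvd k). Qed.

Lemma height_fact k : k`! %| M k.
Proof.
elim: k => [|k IH]; first by rewrite dvd1n.
by rewrite factS; apply: dvdn_trans (height_dvd k); rewrite dvdn_pmul2l.
Qed.

(** The square leaves room for a factor [ln (N k)] when the relative gap is
    summed against the logarithm of the displacement. *)
Lemma gap_small k : (2 ^ k.+1 * (N k - M k)) ^ 2 <= N k.
Proof.
case: k => [|k]; first by rewrite /M /=; have -> : N 0 - (N 0).-1 = 1 by lia.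
have /height_step[_ _ gap] := height_bounds k.
have /andP[_ /ltnW MN] := height_bounds k.
apply: leq_trans (N_growth k); rewrite leq_exp2r // -mulnA leq_mul2l.
by apply/orP; right; apply: (leq_trans gap); apply: leq_mul => //; rewrite leqW.
Qed.

Section step.
Variable k : nat.
Let a := N k.+1 %/ N k.
Let h := M k.+1 %/ M k - a.

Lemma columnsX : a * N k = N k.+1. Proof. by rewrite divnK. Qed.

(** Since [N k.+1 %/ N k] is at least the final gap, and every old column has at
    least one gap level, the gap levels outnumber those that stay unmatched. *)
Lemma columns_le : a <= M k.+1 %/ M k.
Proof.
have /andP[M0 MN] := height_bounds k.
have [_ MN' gap] := height_step (height_bounds k).
rewrite leq_divRL //.
have da : k.+1 * M k <= a.
  rewrite leq_divRL ?N_gt0 //; apply: leq_trans (N_growth_weak k).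
  by rewrite leq_mul2r leq_mul ?orbT // ltnW.
have : a <= a * (N k - M k) by rewrite leq_pmulr // subn_gt0.
have : a * N k = a * M k + a * (N k - M k) by rewrite -mulnDr subnKC // ltnW.
rewrite columnsX; lia.
Qed.

Lemma columnsY : (a + h) * M k = M k.+1.
Proof. by rewrite subnKC ?columns_le // divnK // height_dvd_succ. Qed.

Lemma spare_room : h * M k <= a * (N k - M k).
Proof.
have := columnsY; have /andP[_ /ltnW MN] := height_bounds k.
have /andP[_ /ltnW] := height_bounds k.+1; rewrite -columnsX => + e.
by rewrite -e mulnDl -{1}(subnKC MN) mulnDr leq_add2l.
Qed.

End step.

Lemma stage_perm_perm k :
  (forall i, i < N k -> stage_perm k i < N k) /\
  (forall i i', i < N k -> i' < N k -> stage_perm k i = stage_perm k i' -> i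
    = i').
Proof.
elim: k => [|k [lt inj]] //.
have /andP[M0 MN] := height_bounds k.
split => [i|i i']; rewrite -[N k.+1]columnsX.
  exact: (extend_lt M0 MN (spare_room k) lt).
exact: (extend_inj M0 MN (spare_room k) lt inj).
Qed.

Lemma stage_perm_surj k j : j < N k -> exists2 i, i < N k & stage_perm k i = j.
Proof.
move=> jN; have [lt inj] := stage_perm_perm k.
have u : uniq [seq stage_perm k i | i <- iota 0 (N k)].
  rewrite map_inj_in_uniq ?iota_uniq // => i i'; rewrite !mem_iota !add0n.
  exact: inj.
have sub : {subset [seq stage_perm k i | i <- iota 0 (N k)] <= iota 0 (N k)}.
  by move=> _ /mapP[i + ->]; rewrite !mem_iota !add0n => /lt.
have [|_ e] := uniq_min_size u sub; first by rewrite size_map.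
have : j \in iota 0 (N k) by rewrite mem_iota.
by rewrite -e => /mapP[i]; rewrite mem_iota => iN ->; exists i.
Qed.

Lemma stage_perm_old k c i : i < N k -> stage_perm k i < M k ->
  stage_perm k.+1 (c * N k + i) =
  slot (N k - M k) (M k) (M k.+1 %/ M k - N k.+1 %/ N k) c * M k + stage_perm k
    i.
Proof. by have /andP[M0 MN] := height_bounds k; move=> iN FM;
  apply: extend_old. Qed.

(** Column [c] of the first tower is glued as a whole, so a match persists in
    all the levels above it. *)
Lemma matched_ext k c i j : c * N k + i < N k.+1 -> matched k i j ->
  exists c', matched k.+1 (c * N k + i) (c' * M k + j).
Proof.
move=> cN [iN jM e]; eexists; split=> //; last first.
  by rewrite stage_perm_old // e.
have /andP[M0 _] := height_bounds k.
rewrite -[height k.+1]columnsY; apply: mixed_radix_lt => //.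
have : c < N k.+1 %/ N k.
  by rewrite -(ltn_pmul2r (N_gt0 k)) columnsX; apply: leq_ltn_trans cN;
    rewrite leq_addr.
rewrite /slot; lia.
Qed.

Lemma matching_matched : matching N height matched displacement.
Proof.
split.
- by move=> k i j [].
- by move=> k i j j' [_ _ <-] [_ _ <-].
- move=> k i i' j [iN _ e] [iN' _ e']; have [_ inj] := stage_perm_perm k.
  by apply: inj => //; rewrite e.
- move=> k c c' i i' j j' [iN jM e] [iN' jM' e'] [cN cM].
  have /andP[M0 _] := height_bounds k.
  rewrite stage_perm_old // ?e // => /mixed_radix_inj[] // ec _.
  split.
  + rewrite -columnsX; apply: mixed_radix_lt => //.
    by rewrite -(ltn_pmul2r (N_gt0 k)) columnsX; apply: leq_ltn_trans cN;
      rewrite leq_addr.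
  + rewrite -[height k.+1]columnsY; apply: mixed_radix_lt => //.
    by rewrite -(ltn_pmul2r M0) columnsY; apply: leq_ltn_trans cM;
      rewrite leq_addr.
  + by rewrite stage_perm_old // ?e' // ec.
- case=> [|k] i j [iN jM e]; subst j; first by rewrite addn0.
  have /andP[M0 MN] := height_bounds k.
  have [lt inj] := stage_perm_perm k.
  have H : i <= stage_perm k.+1 i + (N k.+1 - M k.+1 + 4 * N k ^ 2) /\
      stage_perm k.+1 i <= i + (N k.+1 - M k.+1 + 4 * N k ^ 2).
    rewrite -[N k.+1]columnsX -(columnsY k).
    apply: (extend_displacement M0 MN (spare_room k) lt);
      first by rewrite columnsX.
    by rewrite columnsY.
  have [_ _ gap] := height_step (height_bounds k).
  have N2 : M k <= N k ^ 2 by rewrite (leq_trans (ltnW MN)) // leq_pmulr //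
    N_gt0.
  have : k.+1 * M k <= k.+1 * N k ^ 2 by rewrite leq_mul2l N2 orbT.
  move: H gap; rewrite /displacement (mulnDl k.+1 4).
  move: (stage_perm _ _) (M k.+1) (M k) (N k ^ 2) (N k.+1) => p M' m Q N'.
  lia.
Qed.

Lemma displacement_ge k : k <= displacement k.
Proof.
case: k => // k; rewrite /= (leq_trans _ (leq_pmulr _ _)) ?expn_gt0 ?N_gt0 //;
  lia.
Qed.

(** A polynomial in [N k], whatever the size of [N k.+1]. *)
Lemma displacement_le k : displacement k.+1 <= 5 * N k ^ 3.
Proof.
rewrite /= [N k ^ 3]expnS mulnA leq_mul2r; apply/orP; right.
by have := N_ge_index k; lia.
Qed.

End towers.

Local Open Scope classical_set_scope.

(** * Coordinates on an odometer *)

(** The properties of the residues [c k x] modulo [N k] of a point [x] of an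
    odometer from which the rest of the proof is derived. *)
Record chart d (X : measurableType d) (tr : int -> X -> X) (N : nat -> nat)
    (c : nat -> X -> nat) : Prop := Chart {
  chart_dvd : forall k, N k %| N k.+1 ;
  chart_lt : forall k x, c k x < N k ;
  chart_mod : forall k x, c k.+1 x %% N k = c k x ;
  chart_tr : forall k g x,
    (c k (tr g x))%:Z = ((c k x)%:Z + g)%R %[mod (N k)%:Z]%Z ;
  chart_eq : forall x y, (forall k, c k x = c k y) -> x = y ;
  chart_ex : forall z : nat -> nat, (forall k, z k < N k) ->
    (forall k, z k.+1 %% N k = z k) -> exists x, forall k, c k x = z k ;
  chart_meas : forall k i, measurable [set x | c k x = i] ;
  chart_gen : measurable `<=`
    <<s [set A | exists k i, A = [set x | c k x = i]] >> }.

Section odometer_chart.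
Variable n : nat -> nat.
Hypothesis n_gt0 : forall j, 0 < n j.

Lemma modulus_dvd j j' : j <= j' -> modulus n j %| modulus n j'.
Proof.
move=> /subnKC <-; elim: (j' - j) => [|i IH]; first by rewrite addn0.
by rewrite addnS modulusS dvdn_mulr.
Qed.

Lemma residue_lt (x : odometer n) j : residue (val x) j < modulus n j.
Proof. by rewrite -{2}(prednK (modulus_gt0 n_gt0 j)); apply: ltn_ord. Qed.

Lemma residue_mod (x : odometer n) j j' : j <= j' ->
  residue (val x) j' %% modulus n j = residue (val x) j.
Proof.
move=> /subnKC <-; elim: (j' - j) => [|i IH].
  by rewrite addn0 modn_small // residue_lt.
have /set_mem/(_ (j + i)) /(congr1 val)/= := valP x.
rewrite [X in _ %% X = _ -> _](prednK (modulus_gt0 n_gt0 _)) => xj.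
by rewrite addnS -[LHS](modn_dvdm _ (modulus_dvd (leq_addr i j))) xj.
Qed.

Lemma residue_cong (x : odometer n) d j j' :
  d %| modulus n j -> d %| modulus n j' ->
  residue (val x) j = residue (val x) j' %[mod d].
Proof.
wlog le : j j' / j <= j' => [H dj dj'|dj _].
  by case: (leqP j j') => [/H->|/ltnW/H->].
by rewrite -(residue_mod x le) modn_dvdm.
Qed.

(** The filter generated by the cylinders around [x] converges to [x] in the
    product topology, because it does so coordinatewise. *)
Lemma cylinder_nbhs (U : set (odometer n)) x : @open (odometer_top n) U -> U x
  ->
  exists j, [set y : odometer n | forall i, i <= j ->
     residue (val y) i = residue (val x) i] `<=` U.
Proof.
move=> [W oW <-] /= Wx.
pose F : set_system (residues n) := filter_from setT
  (fun j => [set y : residues n | forall i, i <= j -> y i = (val x) i]).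
have FF : Filter F.
  apply: filter_from_filter; first by exists 0.
  move=> i j _ _; exists (maxn i j) => // y yx; split=> l li; apply: yx.
    by rewrite leq_max li.
  by rewrite leq_max li orbT.
have Fx : F --> (val x : residues n).
  apply/cvg_sup => i A [B [[C oC <-]] /= Cx BA].
  exists i => // y yx; apply: BA => /=.
  by rewrite /proj yx.
have [j _ jW] : F W by apply: Fx; rewrite nbhsE; exists W.
by exists j => y yx; apply: jW => i ij; rewrite -[LHS]/(residue _ _) yx.
Qed.

Variables (N J : nat -> nat).
Hypotheses (N_gt0 : forall k, 0 < N k) (N_dvd : forall k, N k %| N k.+1).
Hypothesis NJ : forall k, N k %| modulus n (J k).
Hypothesis cofinal : forall j, exists k, modulus n j %| N k.

(** The chain [N] is only required to be cofinal with the moduli, because the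
    heights of the second tower are in general not partial products. *)
Definition coord (k : nat) (x : odometer n) : nat := residue (val x) (J k) %% N
  k.

Lemma N_dvd_le k l : k <= l -> N k %| N l.
Proof.
move=> /subnKC <-; elim: (l - k) => [|i IH]; first by rewrite addn0.
by rewrite addnS; apply: dvdn_trans (N_dvd _).
Qed.

Lemma coord_residue x j k : N k %| modulus n j ->
  residue (val x) j %% N k = coord k x.
Proof. by move=> Nj; apply: residue_cong. Qed.

Lemma residue_coord x j k : modulus n j %| N k ->
  coord k x %% modulus n j = residue (val x) j.
Proof.
move=> jN; rewrite modn_dvdm //.
by rewrite (@residue_cong x _ (J k) j) ?modn_small ?residue_lt //
  (dvdn_trans jN).
Qed.

Lemma eq_coord_residue x y j k : modulus n j %| N k -> coord k x = coord k y ->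
  residue (val x) j = residue (val y) j.
Proof.
by move=> jN e; apply/val_inj; rewrite /= -(residue_coord x jN) e residue_coord.
Qed.

(** For a negative translation exchange the roles of [x] and its translate. *)
Lemma coord_translate k g x :
  (coord k (translate n_gt0 g x))%:Z = ((coord k x)%:Z + g)%R %[mod (N k)%:Z]%Z.
Proof.
have nat_case a y : coord k (translate n_gt0 a%:Z y) = coord k y + a %[mod N k].
  have pE := prednK (modulus_gt0 n_gt0 (J k)).
  rewrite modn_mod modnDml /coord.
  rewrite -[X in X %% _](_ : (residue (val y) (J k) + a) %% modulus n (J k)
    = _).
    by rewrite modn_dvdm.
  rewrite /= /residue /translate_residues -pmulrn Zp_mulrn /=.
  have aux p q r : p.+1 = q -> (r + a) %% q = (r + (1 %% p.+1 * a) %% p.+1)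
    %% p.+1.
    by move=> <-; rewrite modnMml modnDmr mul1n.
  exact: aux pE.
case: g => a; first by rewrite -PoszD !modz_nat nat_case.
set y := translate _ _ x.
have -> : x = translate n_gt0 a.+1%:Z y.
  by rewrite -translateD NegzE subrr translate0.
have := nat_case a.+1 y; set z := coord k (translate _ _ _) => e.
by rewrite -modzDml (modz_nat z) e -modz_nat modzDml PoszD NegzE addrK.
Qed.

Lemma coord_ex (z : nat -> nat) : (forall k, z k < N k) ->
  (forall k, z k.+1 %% N k = z k) -> exists x, forall k, coord k x = z k.
Proof.
move=> zN zz.
have zle k l : k <= l -> z l %% N k = z k.
  move=> /subnKC <-; elim: (l - k) => [|i IH];
    first by rewrite addn0 modn_small.
  by rewrite addnS -(modn_dvdm _ (N_dvd_le (leq_addr i k))) zz.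
have [K KP] := choice cofinal.
pose u : residues n := fun j => inZp (z (K j)).
have uE j k : modulus n j %| N k -> residue u j = z k %% modulus n j :> nat.
  move=> jk; rewrite /= /u /= prednK ?modulus_gt0 //.
  by case: (leqP (K j) k) => [|/ltnW] /zle <-; rewrite modn_dvdm.
have uc : u \in compatible (n := n).
  apply/mem_set => j; apply/val_inj.
  change (residue u j.+1 %% (modulus n j).-1.+1 = residue u j :> nat).
  rewrite [X in _ %% X = _](prednK (modulus_gt0 n_gt0 _)).
  have jk := KP j.+1; rewrite (uE _ _ jk) modn_dvdm ?modulus_dvd //.
  by rewrite -(uE j) // (dvdn_trans _ jk) // modulus_dvd.
exists (exist _ u uc) => k.
have [k' jk'] := cofinal (J k); rewrite /coord [residue _ _]/=.
rewrite -[X in X %% _]/(residue u (J k) : nat) (uE _ _ jk') modn_dvdm //.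
case: (leqP k k') => [/zle //|/ltnW kk'].
have kk : N k %| N k' by apply: dvdn_trans jk'.
have {}kk : N k = N k' by apply/eqP; rewrite eqn_dvd kk N_dvd_le.
by rewrite -(zle _ _ kk') kk modn_mod -kk modn_small.
Qed.

Lemma measurable_coord k i : measurable [set x | coord k x = i].
Proof.
apply: sub_sigma_algebra.
pose D := discrete_topology (Zmod (modulus n (J k))).
have cf : continuous (fun x : odometer_top n => (val x) (J k) : D).
  move=> x; apply: (@continuous_comp _ _ _ (val : odometer_top n -> residues n)
    (fun y : residues n => (y (J k) : D))).
    exact: initial_continuous.
  exact: (@proj_continuous _ (fun j => discrete_topology (Zmod (modulus n j)))).
move/continuousP : cf => /(_ [set r : D | (r : Zmod _) %% N k = i]); apply.
exact: discrete_open.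
Qed.

(** The cylinders generate the Borel sets because there are countably many of
    them and every open set is the union of those it contains. *)
Lemma coord_chart : chart (translate n_gt0) N coord.
Proof.
split=> //.
- by move=> k x; rewrite ltn_pmod.
- move=> k x; rewrite /coord modn_dvdm //; apply: coord_residue.
  by apply: dvdn_trans (NJ k.+1).
- exact: coord_translate.
- move=> x y e; apply/val_inj/functional_extensionality_dep => j.
  have [k jk] := cofinal j; exact: (eq_coord_residue jk).
- exact: coord_ex.
- exact: measurable_coord.
move=> U; apply: smallest_sub; first exact: smallest_sigma_algebra.
move=> {}U oU.
set G := [set A | exists k i, A = [set x | coord k x = i]].
have -> : U = \bigcup_k \bigcup_i (if `[< [set x | coord k x = i] `<=` U >] then
    [set x | coord k x = i] else set0).
  apply/seteqP; split=> [x Ux|x [k _ [i _]]]; last first.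
    by case: asboolP => // sub /sub.
  have [j jU] := cylinder_nbhs oU Ux; have [k jk] := cofinal j.
  exists k => //; exists (coord k x) => //; case: asboolP => // -[].
  move=> y yx; apply: jU => i ij; apply: (eq_coord_residue _ yx).
  by apply: dvdn_trans jk; exact: modulus_dvd.
apply: sigma_algebra_bigcup => k; apply: sigma_algebra_bigcup => i.
case: ifP => _; last exact: sigma_algebra0.
by apply: sub_sigma_algebra; exists k, i.
Qed.

End odometer_chart.

(** * Chains of moduli *)

(** If the moduli were bounded by [B], they would all divide [B!], and the
    translation by [B!] would be the identity, contradicting freeness. *)
Lemma modulus_unbounded (q : supernatural) (n : nat -> nat) :
  infinitely_many_factors q -> factor_sequence q n ->
  forall B J, exists2 j, J <= j & B <= modulus n j.
Proof.
move=> qinf [n_gt0 nq] B J; apply: contrapT => bounded.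
have mB j : modulus n j %| B`!.
  apply: dvdn_trans (modulus_dvd n (leq_addl J j)) _.
  apply: dvdn_fact; rewrite modulus_gt0 //= leqNgt; apply/negP => /ltnW Bj.
  by apply: bounded; exists (J + j); rewrite ?leq_addr.
suff /(translate_free qinf nq) : translate n_gt0 (B`!)%:Z point = point.
  by move=> [] e; have := fact_gt0 B; rewrite e.
apply/val_inj/functional_extensionality_dep => j; apply/val_inj.
rewrite /= /translate_residues -pmulrn Zp_mulrn /= prednK ?modulus_gt0 //.
rewrite modnMml mul1n (eqP (mB j)) addn0 modn_small //.
exact: (residue_lt n_gt0 point j).
Qed.

Lemma dvdn_modulus_universal (m : nat -> nat) :
  factor_sequence universal_supernatural m ->
  forall d, 0 < d -> exists j, d %| modulus m j.
Proof.
move=> [m_gt0 mP] d d0.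
have logP p : exists J, prime p -> forall j, J <= j -> logn p d <= logn p
  (modulus m j).
  have [pp|] := boolP (prime p); last by exists 0.
  have [J HJ] := mP p pp (logn p d); exists J => _ j Jj.
  apply: leq_trans HJ _.
  have -> : logn p (modulus m j) = \sum_(i < j.+1) logn p (m i).
    rewrite /modulus; elim: j.+1 => [|i IH]; first by rewrite !big_ord0 logn1.
    by rewrite !big_ord_recr /= lognM ?IH // prodn_gt0.
  rewrite -!(big_mkord xpredT (fun i => logn p (m i)))
    [leqRHS](@big_cat_nat _ _ _ J) //=.
    exact: leq_addr.
  exact: leqW.
have [J JP] := choice logP; exists (\max_(p <- primes d) J p).
apply/dvdn_partP => // p pd; rewrite p_part.
have pp : prime p by move: pd; rewrite mem_primes => /andP[].
rewrite pfactor_dvdn // ?modulus_gt0 //; apply: JP => //.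
exact: leq_bigmax_seq.
Qed.

Lemma fast_subsequence (q : supernatural) (n : nat -> nat) :
  infinitely_many_factors q -> factor_sequence q n ->
  exists J : nat -> nat, [/\ 4 <= modulus n (J 0), forall k, k <= J k,
    forall k, J k <= J k.+1 &
    forall k, (2 ^ k.+2 * k.+3 * modulus n (J k)) ^ 2 <= modulus n (J k.+1)].
Proof.
move=> qinf nq; have unb := modulus_unbounded qinf nq.
have [j0 _ j0P] := unb 4 0.
have nextP (x : nat * nat) : exists j, x.2 < j /\
    (2 ^ x.1.+2 * x.1.+3 * modulus n x.2) ^ 2 <= modulus n j.
  by have [j] := unb ((2 ^ x.1.+2 * x.1.+3 * modulus n x.2) ^ 2) x.2.+1;
    exists j.
have [next nextE] := choice nextP.
pose J := fix J k := if k is k'.+1 then next (k', J k') else j0.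
have JS k : J k < J k.+1 by have [] := nextE (k, J k).
exists J; split=> // [|k|k].
- by elim=> // k /leq_ltn_trans; apply.
- exact: ltnW.
- by have [_] := nextE (k, J k).
Qed.

Local Open Scope ring_scope.

(** * A criterion for finite entropy *)

Lemma measure_bigcup_seq (R : realType) d (X : measurableType d)
    (mu : {measure set X -> \bar R}) (I : choiceType) (s : seq I)
      (F : I -> set X) :
  uniq s -> (forall i, measurable (F i)) -> trivIset setT F ->
  mu (\bigcup_(i in [set` s]) F i) = (\sum_(i <- s) mu (F i))%E.
Proof.
move=> us mF tF; rewrite measure_fin_bigcup //.
- by rewrite -fsbig_seq.
- exact: sub_trivIset tF.
Qed.

Section entropy_criterion.
Context (R : realType).

(** Gibbs' inequality for one term, from [ln t <= t - 1] at [t = r / p]. *)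
Lemma xlnx_le (p r : R) : 0 <= p -> 0 < r -> - (p * ln p) <= r - p * ln r.
Proof.
rewrite le_eqVlt => /orP[/eqP <- r0|p0 r0].
  by rewrite !mul0r oppr0 addr0 ltW.
have : ln (1 + (r / p - 1)) <= r / p - 1.
  by apply: le_ln1Dx; rewrite -subr_gt0 opprK subrK divr_gt0.
rewrite addrC subrK ln_div ?posrE // -(ler_pM2l p0) !mulrBr mulrCA divff ?gt_eqF
  //.
lra.
Qed.

Let wt (m : nat) : R := (m.+1 * m.+2)%:R^-1.

(** The sum of all weights telescopes: [wt m = 1 / m.+1 - 1 / m.+2]. *)
Lemma sum_wt_le1 (t : seq nat) : uniq t -> \sum_(m <- t) wt m <= 1.
Proof.
move=> ut; pose K := (\max_(m <- t) m).+1.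
have tK m : m \in t -> (m < K)%N by move=> mt; rewrite ltnS leq_bigmax_seq.
suff : \sum_(m <- t) wt m <= 1 - K.+1%:R^-1.
  by move=> /le_trans; apply; rewrite gerBl invr_ge0 ler0n.
move: K tK => K; elim: K t ut => [|K IH] t ut tK.
  case: t ut tK => [|m t] _ tK; first by rewrite big_nil invr1 subrr.
  by have := tK m (mem_head _ _).
have step : 1 - K.+1%:R^-1 + wt K = 1 - K.+2%:R^-1 :> R.
  rewrite /wt natrM; have := @ltr0Sn R K; have := @ltr0Sn R K.+1.
  rewrite -(natr1 K.+1); move: (K.+1%:R) => z z1 z0.
  by field; rewrite !gt_eqF.
have [Kt|Kt] := boolP (K \in t).
  rewrite (big_rem _ Kt) /= addrC -step lerD2r; apply: IH;
    first exact: rem_uniq.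
  move=> m; rewrite mem_rem_uniq // inE => /andP[/= mK /tK].
  by rewrite ltnS leq_eqVlt (negbTE mK).
apply: (@le_trans _ _ (1 - K.+1%:R^-1)).
  apply: IH => // m mt; have := tK _ mt;
    rewrite ltnS leq_eqVlt => /predU1P[e|//].
  by rewrite -e mt in Kt.
by rewrite -step lerDl invr_ge0 ler0n.
Qed.

Let code (i : int) : nat := match i with Posz n => n.*2 | Negz n => n.*2.+1 end.

Lemma code_inj : injective code.
Proof. by move=> [m|m] [n|n] /=; lia. Qed.

Let logw (i : nat) : R := ln (2 + 2 * i%:R).

Lemma wt_gt0 m : 0 < wt m. Proof. by rewrite invr_gt0 ltr0n. Qed.

Lemma logw_arg_gt0 (i : nat) : 0 < 2 + 2 * i%:R :> R.
Proof. by rewrite ltr_wpDr // mulr_ge0. Qed.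

Lemma logw_ge0 i : 0 <= logw i.
Proof. by rewrite ln_ge0 //; have := ler0n R i; lra. Qed.

Lemma logw_le i j : (i <= j)%N -> logw i <= logw j.
Proof.
by move=> ij; rewrite ler_ln ?posrE ?logw_arg_gt0 // lerD2l ler_pM2l // ler_nat.
Qed.

(** Both factors [(code i).+1] and [(code i).+2] of the inverse weight are at
    most [2 + 2 * `|i|]. *)
Lemma ln_wt_le i : - ln (wt (code i)) <= 2 * logw `|i|%N.
Proof.
have [e1 e2] : ((code i).+1 <= 2 + 2 * `|i|)%N /\
  ((code i).+2 <= 2 + 2 * `|i|)%N.
  by case: i => n /=; lia.
have p0 m : (0 : R) < m.+1%:R by rewrite ltr0n.
rewrite /wt lnV ?posrE ?ltr0n // opprK natrM lnM ?posrE // mulr2n mulrDl mul1r.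
have le m : (m.+1 <= 2 + 2 * `|i|)%N -> ln m.+1%:R <= logw `|i|.
  move=> mi; rewrite ler_ln ?posrE ?logw_arg_gt0 //.
  by rewrite -natrM -natrD ler_nat.
by rewrite lerD // le.
Qed.

(** Summation by parts against the tail events [T k < i]. *)
Lemma logw_layers (T : nat -> nat) K i : (i <= T K)%N ->
  logw i <= logw (T 0) + \sum_(k < K) (T k < i)%N%:R * logw (T k.+1).
Proof.
elim: K => [|K IH] iK; first by rewrite big_ord0 addr0 logw_le.
rewrite big_ord_recr /=; case: (ltnP (T K) i) => [Ki|/IH le].
  rewrite mul1r addrA -[logw i]add0r lerD ?logw_le // addr_ge0 ?logw_ge0 //.
  by apply: sumr_ge0 => k _; rewrite mulr_ge0 // logw_ge0.
by rewrite mul0r addr0.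
Qed.

Lemma sum_geometric_le (K : nat) : \sum_(k < K) (2 ^+ k)^-1 <= 2 :> R.
Proof.
suff : \sum_(k < K) (2 ^+ k)^-1 = 2 - 2 * (2 ^+ K)^-1 :> R.
  by move=> ->; rewrite gerBl mulr_ge0 // invr_ge0 exprn_ge0.
elim: K => [|K IH]; first by rewrite big_ord0 expr0 invr1 mulr1 subrr.
rewrite big_ord_recr /= IH exprS invfM; field.
exact: expf_neq0.
Qed.

(** Comparing [p] with the summable weights [wt (code i)] bounds the entropy by
    the mean of [2 * ln (2 + 2 * `|i|)], and the mean is bounded by the
    tails. *)
Lemma finite_entropy_le (p : int -> R) (s : seq int) (T : nat -> nat)
    (del : nat -> R) (C : R) (K : nat) :
  uniq s -> 0 <= C -> (forall i, 0 <= p i) -> \sum_(i <- s) p i <= 1 ->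
  (forall i, i \in s -> (`|i| <= T K)%N) ->
  (forall k, \sum_(i <- s | (T k < `|i|)%N) p i <= del k) ->
  (forall k, del k * logw (T k.+1) <= C / 2 ^+ k) ->
  \sum_(i <- s) - (p i * ln (p i)) <= 1 + 2 * (logw (T 0) + 2 * C).
Proof.
move=> us C0 p0 p1 sK tail decay.
apply: (@le_trans _ _ (\sum_(i <- s) (wt (code i) + 2 * (p i * logw `|i|)))).
  apply: ler_sum => i _; apply: le_trans (xlnx_le (p0 i) (wt_gt0 (code i))) _.
  by rewrite lerD2l -mulrN mulrCA ler_wpM2l // ln_wt_le.
rewrite big_split /= lerD //.
  by rewrite -(big_map code xpredT wt) sum_wt_le1 // map_inj_uniq //;
    exact: code_inj.
rewrite -mulr_sumr ler_pM2l //.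
apply: (@le_trans _ _ (\sum_(i <- s) (p i * logw (T 0) +
    \sum_(k < K) (T k < `|i|)%N%:R * p i * logw (T k.+1)))).
  rewrite big_seq [leRHS]big_seq; apply: ler_sum => i /sK /logw_layers le.
  apply: le_trans (ler_wpM2l (p0 i) le) _; rewrite mulrDr lerD2l mulr_sumr.
  by apply: ler_sum => k _; rewrite mulrCA mulrA.
rewrite big_split /= lerD //.
  by rewrite -mulr_suml ler_piMl // logw_ge0.
rewrite exchange_big /=; apply: (@le_trans _ _ (\sum_(k < K) C * (2 ^+ k)^-1)).
  apply: ler_sum => k _; rewrite -mulr_suml; apply: le_trans (decay k).
  apply: ler_wpM2r; first exact: logw_ge0.
  apply: le_trans (tail k); rewrite [leRHS]big_mkcond /=; apply: ler_sum => i _.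
  by case: ifP; rewrite ?mul1r ?mul0r.
by rewrite -mulr_sumr mulrC ler_wpM2r // sum_geometric_le.
Qed.

(** A random integer whose logarithm is integrable has finite entropy; here the
    logarithm is controlled by its tails at the thresholds [T k]. *)
Lemma entropy_finite d (X : measurableType d) (mu : probability X R)
    (P : int -> set X) (T : nat -> nat) (del : nat -> R) (C : R) :
  (forall i, measurable (P i)) -> trivIset setT P -> 0 <= C ->
  (forall i, exists K, forall k, (K <= k)%N -> (i <= T k)%N) ->
  (forall k, exists2 E, measurable E /\ (mu E <= (del k)%:E)%E &
     forall i, (T k < `|i|)%N -> P i `<=` E) ->
  (forall k, del k * ln (2 + 2 * (T k.+1)%:R) <= C / 2 ^+ k) ->
  (entropy mu P < +oo)%E.
Proof.
move=> mP tP C0 Tinf tail decay.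
pose p i := fine (mu (P i)).
have pE i : mu (P i) = (p i)%:E by rewrite fineK // fin_num_measure.
have sumE (s : seq int) : uniq s ->
    mu (\bigcup_(i in [set` s]) P i) = (\sum_(i <- s) p i)%:E.
  by move=> us; rewrite measure_bigcup_seq // -sumEFin; apply: eq_bigr => i _;
    exact: pE.
have mU (s : seq int) : measurable (\bigcup_(i in [set` s]) P i).
  by apply: fin_bigcup_measurable => //; exact: finite_seq.
apply: (@le_lt_trans _ _ (1 + 2 * (logw (T 0) + 2 * C))%:E); last exact: ltry.
apply: ge_ereal_sup => _ [A [finA _] <-].
rewrite fsbig_finite // sumEFin lee_fin.
have := finmap.fset_uniq (fset_set A).
move: (finmap.enum_fset _) => s us.
have [K sK] : exists K, forall k, (K <= k)%N -> forall i, i \in s ->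
  (`|i| <= T k)%N.
  elim: (s) => [|i s' [K IH]]; first by exists 0%N.
  have [K' HK'] := Tinf `|i|%N; exists (maxn K K') => k;
    rewrite geq_max => /andP[Kk K'k].
  by move=> j; rewrite inE => /predU1P[->|/IH]; [exact: HK'|exact].
apply: (@finite_entropy_le p s T del C K) => //.
- by move=> i; rewrite fine_ge0.
- by rewrite -lee_fin -sumE // probability_le1.
- exact: sK.
- move=> k; rewrite -big_filter -lee_fin -sumE ?filter_uniq //.
  have [E [mE muE] PE] := tail k; apply: le_trans muE.
  apply: le_measure; rewrite ?inE // => x [i /=].
  by rewrite mem_filter => /andP[/PE PiE _] /PiE.
Qed.
End entropy_criterion.

(** * Coordinates and measure *)

Section chart_theory.
Context d (X : measurableType d) (tr : int -> X -> X) (N : nat -> nat)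
  (c : nat -> X -> nat) (H : chart tr N c).

Lemma chart_N_gt0 k : (0 < N k)%N.
Proof. exact: leq_ltn_trans (chart_lt H k point). Qed.

Lemma chart_mod_le k l x : (k <= l)%N -> (c l x %% N k)%N = c k x.
Proof.
move=> /subnKC <-; elim: (l - k)%N => [|i IH].
  by rewrite addn0 modn_small // (chart_lt H).
have dvd : (N k %| N (k + i))%N.
  elim: (i) => [|j]; first by rewrite addn0.
  by rewrite addnS => /dvdn_trans; apply; exact: chart_dvd H _.
by rewrite addnS -(modn_dvdm _ dvd) (chart_mod H).
Qed.

Lemma chart_col k x : exists2 q, c k.+1 x = (q * N k + c k x)%N &
  (q.+1 * N k <= N k.+1)%N.
Proof.
exists (c k.+1 x %/ N k)%N; first by rewrite -(chart_mod H k x) -divn_eq.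
rewrite -[leqRHS](divnK (chart_dvd H k)) leq_mul2r ltn_divLR ?chart_N_gt0 //.
by rewrite divnK ?(chart_dvd H) // (chart_lt H) orbT.
Qed.

Lemma chart_translate k g x : 0 <= (c k x)%:Z + g < (N k)%:Z ->
  (c k (tr g x))%:Z = (c k x)%:Z + g.
Proof.
move=> r; have := chart_tr H k g x; rewrite modz_small ?(modz_small r) //.
by rewrite lez_nat leq0n ltz_nat (chart_lt H).
Qed.

(** At the next stage the residues of [x] and its translate lie in the same
    column of height [N k], so the translation still produces no carry. *)
Lemma chart_range_le k l g x : (k <= l)%N -> 0 <= (c k x)%:Z + g < (N k)%:Z ->
  0 <= (c l x)%:Z + g < (N l)%:Z.
Proof.
move=> /subnKC <-; elim: (l - k)%N => [|i IH]; first by rewrite addn0.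
move=> /IH; rewrite addnS; have [q -> qN] := chart_col (k + i) x.
by rewrite mulSn in qN; lia.
Qed.

Lemma measurable_chart k (P : set nat) : measurable [set x | P (c k x)].
Proof.
have -> : [set x | P (c k x)] = \bigcup_(i in P) [set x | c k x = i].
  by apply/seteqP; split=> [x Px|x [i Pi /= ->]] //; exists (c k x).
by apply: bigcup_measurable => i _; exact: chart_meas H _ _.
Qed.

Lemma measurable_fun_chart d' (Y : measurableType d') (D : set Y) (f : Y -> X) :
  (forall k i, measurable (D `&` [set y | c k (f y) = i])) -> measurable_fun D
    f.
Proof.
move=> Df; apply: (@measurability _ _ Y X D f
  [set A | exists k i, A = [set x | c k x = i]]).
  apply/seteqP; split; first exact: chart_gen H.
  apply: smallest_sub; first exact: sigma_algebra_measurable.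
  by move=> _ [k [i ->]]; exact: chart_meas H _ _.
by move=> _ [_ [k [i ->]] <-]; exact: Df.
Qed.

End chart_theory.

Section chart_measure.
Context (R : realType) d (X : measurableType d) (mu : probability X R)
  (a : free_pmp_action mu) (N : nat -> nat) (c : nat -> X -> nat)
  (H : chart a N c).

Let cyl0 k i : (i < N k)%N -> mu [set x | c k x = i] = mu [set x | c k x = 0%N].
Proof.
move=> iN; rewrite -[RHS](invariant_act a (- i%:Z));
  last exact: chart_meas H _ _.
congr (mu _); apply/seteqP; split=> x /= ci.
  have := @chart_translate _ _ _ _ _ H k (- i%:Z) x; rewrite ci subrr.
  by rewrite lexx ltz_nat (chart_N_gt0 H) => /(_ isT) [].
have e : x = a i%:Z (a (- i%:Z) x) by rewrite -actD subrr act0.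
have := @chart_translate _ _ _ _ _ H k i%:Z (a (- i%:Z) x); rewrite ci add0r -e.
by rewrite lez_nat leq0n ltz_nat iN => /(_ isT) [].
Qed.

Let cylE k (s : seq nat) : uniq s -> {subset s <= iota 0 (N k)} ->
  mu [set x | c k x \in s] = ((size s)%:R%:E * mu [set x | c k x = 0%N])%E.
Proof.
move=> us sN.
have -> : [set x | c k x \in s] = \bigcup_(i in [set` s]) [set x | c k x = i].
  by apply/seteqP; split=> [x Px|x [i Pi /= ->]] //; exists (c k x).
rewrite measure_bigcup_seq //; last first.
- by apply/trivIsetP => i j _ _ ij; apply/seteqP; split=> // x [/= -> e];
    rewrite e eqxx in ij.
- by move=> i; exact: chart_meas H _ _.
rewrite (eq_big_seq (fun=> mu [set x | c k x = 0%N])); last first.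
  by move=> i /sN; rewrite mem_iota => /= /cyl0.
have fin : mu [set x | c k x = 0%N] \is a fin_num.
  by apply: fin_num_measure; exact: chart_meas H _ _.
rewrite -(fineK fin) sumEFin -EFinM big_const_seq count_predT iter_addr_0.
by rewrite mulr_natl.
Qed.

(** By invariance the [N k] cylinders of stage [k] have the same measure. *)
Lemma chart_measure k (s : seq nat) : uniq s -> {subset s <= iota 0 (N k)} ->
  mu [set x | c k x \in s] = ((size s)%:R / (N k)%:R)%:E.
Proof.
move=> us sN; rewrite cylE //.
have := @cylE k (iota 0 (N k)) (iota_uniq _ _) (fun=> id); rewrite size_iota.
have -> : [set x | c k x \in iota 0 (N k)] = setT.
  by apply/seteqP; split=> x //= _; rewrite mem_iota (chart_lt H).
have fin : mu [set x | c k x = 0%N] \is a fin_num.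
  by apply: fin_num_measure; exact: chart_meas H _ _.
rewrite probability_setT -(fineK fin) -!EFinM => -[e]; congr EFin.
have N0 : (N k)%:R != 0 :> R by rewrite pnatr_eq0 -lt0n (chart_N_gt0 H).
by apply: (mulIf N0); rewrite divfK // -mulrA [_ * (N k)%:R]mulrC -e mulr1.
Qed.

Lemma chart_measureP k (P : pred nat) :
  mu [set x | P (c k x)] = ((count P (iota 0 (N k)))%:R / (N k)%:R)%:E.
Proof.
rewrite -size_filter -chart_measure ?filter_uniq ?iota_uniq //.
  by congr (mu _); apply/seteqP; split=> x /=;
    rewrite mem_filter mem_iota (chart_lt H) leq0n !andbT.
by move=> i; rewrite mem_filter => /andP[].
Qed.

End chart_measure.

(** * Points linked by a matching *)

Definition linked (X Y : Type) (c : nat -> X -> nat) (e : nat -> Y -> nat)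
    (R : nat -> nat -> nat -> Prop) (k : nat) (x : X) (y : Y) : Prop :=
  forall l, (k <= l)%N -> R l (c l x) (e l y).

Definition linkable_from (X Y : Type) (c : nat -> X -> nat)
  (e : nat -> Y -> nat)
    (R : nat -> nat -> nat -> Prop) (k : nat) : set X :=
  [set x | exists y, linked c e R k x y].

(** By [linked_unique] there is at most one candidate. *)
Definition partner (X : Type) (Y : pointedType) (c : nat -> X -> nat)
  (e : nat -> Y -> nat)
    (R : nat -> nat -> nat -> Prop) (x : X) : Y :=
  xget point [set y | exists k, linked c e R k x y].

Lemma linked_le (X Y : Type) (c : nat -> X -> nat) (e : nat -> Y -> nat)
    (R : nat -> nat -> nat -> Prop) k l x y : (k <= l)%N ->
  linked c e R k x y -> linked c e R l x y.
Proof. by move=> kl xy i li; apply: xy; exact: leq_trans li. Qed.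

Section linked.
Context d1 (X : measurableType d1) (a : int -> X -> X) (N : nat -> nat)
  (c : nat -> X -> nat) (HX : chart a N c).
Context d2 (Y : measurableType d2) (b : int -> Y -> Y) (M : nat -> nat)
  (e : nat -> Y -> nat) (HY : chart b M e).
Variables (Q : nat -> nat -> nat -> Prop) (D : nat -> nat).
Hypothesis HQ : matching N M Q D.

Local Notation link := (linked c e Q).
Local Notation G := (linkable_from c e Q).
Local Notation phi := (partner c e Q).

Lemma linked_unique k l x y y' : link k x y -> link l x y' -> y = y'.
Proof.
move=> xy xy'; apply: (chart_eq HY) => i.
pose j := maxn i (maxn k l).
rewrite -(@chart_mod_le _ _ _ _ _ HY i j) ?leq_maxl //.
rewrite -(@chart_mod_le _ _ _ _ _ HY i j y') ?leq_maxl //.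
congr (_ %% _)%N; apply: (match_fun HQ (xy j _) (xy' j _)); rewrite /j; lia.
Qed.

Lemma partnerE k x y : link k x y -> phi x = y.
Proof.
move=> xy; apply: xget_unique; first by exists k.
by move=> z [l xz]; exact: linked_unique xz xy.
Qed.

Lemma partner_linked k x : G k x -> link k x (phi x).
Proof. by move=> [y xy]; rewrite (partnerE xy). Qed.

Lemma linkable_from_le k l : (k <= l)%N -> G k `<=` G l.
Proof. by move=> kl x [y /(linked_le kl) xy]; exists y. Qed.

Let step l : set X := [set x | exists j j', [/\ Q l (c l x) j,
  Q l.+1 (c l.+1 x) j' & (j' %% M l)%N = j]].

(** The levels matched with the residues of [x] determine the residues of the
    partner; these are compatible exactly when each stage refines the previous
    one, a condition on one coordinate at a time, hence measurable. *)
Lemma linkable_fromE k : G k = \bigcap_(l in [set l | (k <= l)%N]) step l.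
Proof.
apply/seteqP; split=> [x [y xy] l /= kl|x sx].
  exists (e l y), (e l.+1 y); split;
    [exact: xy|apply: xy|exact: chart_mod HY _ _].
  exact: leqW.
have jP l : exists j, (k <= l)%N -> Q l (c l x) j.
  by case: (leqP k l) => [/sx [j [_ [Qj _ _]]]|_]; [exists j|exists 0%N].
have {jP} [j jP] := choice jP.
have jM l : (k <= l)%N -> (j l < M l)%N by move=> /jP /(match_lt HQ)[].
have jmod l : (k <= l)%N -> (j l.+1 %% M l)%N = j l.
  move=> kl; have [i [i' [Qi Qi' ii']]] := sx l kl.
  by rewrite (match_fun HQ (jP _ (leqW kl)) Qi') (match_fun HQ (jP _ kl) Qi).
(* Before stage [k] the residues of the partner come from those at stage [k]. *)
pose z l := (j (maxn k l) %% M l)%N.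
have zM l : (z l < M l)%N by rewrite ltn_mod (chart_N_gt0 HY).
have zz l : (z l.+1 %% M l)%N = z l.
  rewrite /z modn_dvdm ?(chart_dvd HY) //; case: (leqP k l) => kl.
    have -> : maxn k l.+1 = l.+1 by lia.
    by rewrite jmod // modn_small // jM.
  by have -> : maxn k l.+1 = k by lia.
have [y yz] := chart_ex HY zM zz; exists y => l kl.
rewrite yz /z; have -> : maxn k l = l by lia.
by rewrite modn_small ?jM //; exact: jP.
Qed.

Lemma measurable_linkable_from k : measurable (G k).
Proof.
rewrite linkable_fromE; apply: bigcap_measurable; first by exists k => /=.
move=> l _; have -> : step l
  = [set x | exists j j', [/\ Q l (c l.+1 x %% N l)%N j,
  Q l.+1 (c l.+1 x) j' & (j' %% M l)%N = j]].
  by apply/seteqP; split=> x /=; rewrite (chart_mod HX).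
exact: (measurable_chart HX l.+1 [set i | exists j j', [/\ Q l (i %% N l)%N j,
  Q l.+1 i j' & (j' %% M l)%N = j]]).
Qed.

Definition linkable : set X := \bigcup_k G k.

Lemma measurable_linkable : measurable linkable.
Proof. by apply: bigcup_measurable => k _; exact: measurable_linkable_from. Qed.

Lemma measurable_partner : measurable_fun linkable phi.
Proof.
apply: (measurable_fun_chart HY) => k i.
have -> : linkable `&` [set x | e k (phi x) = i] =
    \bigcup_(l in [set l | (k <= l)%N])
      (G l `&` [set x | exists j, Q l (c l x) j /\ (j %% M k)%N = i]).
  apply/seteqP; split=> [x [[l _ xl] /= ei]|x [l /= kl [xl [j [xj <-]]]]].
    exists (maxn k l); rewrite /= ?leq_maxl //.
    have {}xl := linkable_from_le (leq_maxr k l) xl; split=> //.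
    exists (e (maxn k l) (phi x)); split; first exact: (partner_linked xl).
    by rewrite (chart_mod_le HY) // leq_maxl.
  split; first by exists l.
  have /(_ l (leqnn _)) xy := partner_linked xl.
  by rewrite /= (match_fun HQ xj xy) (chart_mod_le HY).
apply: bigcup_measurable => l _; apply: measurableI;
  first exact: measurable_linkable_from.
exact: (measurable_chart HX l [set m | exists j, Q l m j /\ (j %% M k)%N = i]).
Qed.

Definition same_column (g : int) (k : nat) : set X :=
  [set x | [/\ G k x, G k (a g x) & 0 <= (c k x)%:Z + g < (N k)%:Z]].

Lemma same_column_le g k l : (k <= l)%N -> same_column g k `<=` same_column g l.
Proof.
move=> kl x [x1 x2 x3]; split;
  [exact: linkable_from_le x1|exact: linkable_from_le x2|].
exact: chart_range_le HX _ _ _ _ kl x3.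
Qed.

(** By induction on the stage: the residues of [x] and its translate lie in the
    same column, which is glued rigidly, so those of the partners keep the same
    difference. *)
Lemma linked_translate g k x y y' : link k x y -> link k (a g x) y' ->
  0 <= (c k x)%:Z + g < (N k)%:Z ->
  let s := (e k y')%:Z - (e k y)%:Z in
  y' = b s y /\ (`|s| <= `|g| + 2 * D k)%N.
Proof.
move=> xy xy' r s; split; last first.
  have := match_disp HQ (xy k (leqnn _));
    have := match_disp HQ (xy' k (leqnn _)).
  have := chart_translate HX r; rewrite /s; lia.
have key l : (k <= l)%N -> (e l y')%:Z = (e l y)%:Z + s.
  move=> /subnKC <-; elim: (l - k)%N => [|i]; first by rewrite addn0 /s; lia.
  set m := (k + i)%N => IH; rewrite addnS -/m.
  have km : (k <= m)%N by exact: leq_addr.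
  have rm := chart_range_le HX km r; have rm1 := chart_range_le HX (leqW km) r.
  have [q xq _] := chart_col HX m x; have [q' yq _] := chart_col HY m y.
  have Q1 := xy _ (leqW km); rewrite xq yq in Q1.
  have := match_col HQ (xy _ km) (xy' _ km) Q1.
  have -> : (q * N m + c m (a g x))%N = c m.+1 (a g x).
    by have := chart_translate HX rm; have := chart_translate HX rm1; lia.
  move=> /(match_fun HQ (xy' _ (leqW km))) ->; rewrite yq; lia.
apply: (chart_eq HY) => i; pose j := maxn i k.
have ij : (i <= j)%N by exact: leq_maxl.
rewrite -(chart_mod_le HY y' ij) -(chart_mod_le HY (b s y) ij).
congr (_ %% _)%N; have := chart_tr HY j s y; rewrite -key ?leq_maxr //.
rewrite !modz_nat => -[]; rewrite !modn_small ?(chart_lt HY) //.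
Qed.

End linked.

(** * Almost every point is settled *)

(** Only the first or the last [`|g|] levels of a tower leave it under
    translation by [g]. *)
Lemma count_escape (N : nat) (g : int) :
  (count (fun i : nat => ~~ (0 <= i%:Z + g < N%:Z)%R) (iota 0 N) <= `|g|)%N.
Proof.
rewrite -size_filter.
pose s := match g with Posz n => iota (N - n) n | Negz n => iota 0 n.+1 end.
have -> : `|g|%N = size s by case: (g) @s => n /=; rewrite size_iota.
apply: uniq_leq_size; first by rewrite filter_uniq // iota_uniq.
move=> i; rewrite mem_filter mem_iota /s; case: (g) => n; rewrite mem_iota; lia.
Qed.

Section recurrence.
Context (R : realType) d1 (X : measurableType d1) (mu : probability X R)
  (a : free_pmp_action mu) (N : nat -> nat) (c : nat -> X -> nat)
  (HX : chart a N c).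
Context d2 (Y : measurableType d2) (b : int -> Y -> Y) (M : nat -> nat)
  (e : nat -> Y -> nat) (HY : chart b M e).
Variables (Q : nat -> nat -> nat -> Prop) (D : nat -> nat).
Hypothesis HQ : matching N M Q D.

Local Notation G := (linkable_from c e Q).
Local Notation same := (same_column a N c e Q).

Lemma measurable_same_column g k : measurable (same g k).
Proof.
have -> : same g k = G k `&` a g @^-1` (G k) `&`
  [set x | (0 <= (c k x)%:Z + g < (N k)%:Z)].
  by apply/seteqP; split=> [x []|x [[]]].
have mG := measurable_linkable_from HX HY HQ k.
apply: measurableI; last exact:
  (measurable_chart HX k [set i | 0 <= i%:Z + g < (N k)%:Z]).
apply: measurableI => //; rewrite -[X in measurable X]setTI.
exact: measurable_act.
Qed.

Variable eps : nat -> R.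
Hypothesis linkable_from_eps : forall k, (mu (~` G k) <= (eps k)%:E)%E.
Hypothesis N_eps : forall k, (N k)%:R^-1 <= eps k.

Lemma same_column_eps g k :
  (mu (~` same g k) <= ((2 + `|g|%N%:R) * eps k)%:E)%E.
Proof.
have mG := measurable_linkable_from HX HY HQ k.
have mGc : measurable (~` G k) by exact: measurableC.
pose E := [set x | ~~ (0 <= (c k x)%:Z + g < (N k)%:Z)].
have mE : measurable E.
  exact: (measurable_chart HX k [set i | ~~ (0 <= i%:Z + g < (N k)%:Z)]).
have ma : measurable (a g @^-1` (~` G k)).
  by rewrite -[X in measurable X]setTI; exact: measurable_act.
have muA : (mu (a g @^-1` (~` G k)) <= (eps k)%:E)%E.
  by rewrite (invariant_act a g mGc).
have sub : ~` same g k `<=` ~` G k `|` a g @^-1` (~` G k) `|` E.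
  move=> x nx; apply: contrapT =>
    /not_orP[/not_orP[/contrapT x1 /contrapT x2] /negP].
  by rewrite negbK => x3; apply: nx.
have muE : (mu E <= (`|g|%N%:R * eps k)%:E)%E.
  rewrite (chart_measureP HX k (fun i => ~~ (0 <= i%:Z + g < (N k)%:Z)))
    lee_fin.
  by rewrite ler_pM // ?invr_ge0 ?ler_nat ?count_escape.
apply: (@le_trans _ _ (mu (~` G k `|` a g @^-1` (~` G k) `|` E))).
  apply: le_measure => //; rewrite inE; last by do 2?apply: measurableU.
  by apply: measurableC; exact: measurable_same_column.
apply: (le_trans (measureU2 _ _ _)) => //; first exact: measurableU.
rewrite mulrDl EFinD leeD // mulr2n mulrDl mul1r EFinD.
apply: (le_trans (measureU2 _ _ _)) => //.
by apply: leeD; [exact: linkable_from_eps|exact: muA].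
Qed.

(** The points that have a partner and eventually lie in the same column as any
    given translate; this excludes the orbit of zero. *)
Definition settled : set X := [set x | forall g, exists k, same g k x].

Lemma settledE : settled = \bigcap_(n : nat)
  ((\bigcup_k same n%:Z k) `&` (\bigcup_k same (- n%:Z) k)).
Proof.
apply/seteqP; split=> [x cx n _|x cx g].
  by have [k xk] := cx n%:Z; have [k' xk'] := cx (- n%:Z); split;
    [exists k|exists k'].
have [[k _ xk] [k' _ xk']] := cx `|g|%N I.
have [->|->] : g = `|g|%N%:Z \/ g = - `|g|%N%:Z by lia.
  by exists k.
by exists k'.
Qed.

Lemma measurable_settled : measurable settled.
Proof.
rewrite settledE; apply: bigcapT_measurable => n.
by apply: measurableI; apply: bigcupT_measurable => k;
  exact: measurable_same_column.
Qed.

Hypothesis eps_small : forall k, eps k <= (2 ^+ k)^-1.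

Lemma settled_conull : mu (~` settled) = 0%E.
Proof.
have mU g : measurable (~` \bigcup_k same g k).
  by apply: measurableC; apply: bigcupT_measurable => k;
    exact: measurable_same_column.
have U0 g : mu (~` \bigcup_k same g k) = 0%E.
  apply/eqP; rewrite eq_le measure_ge0 andbT.
  apply/lee_addgt0Pr => z z0; rewrite add0e.
  have [k kz] : exists k, (2 + `|g|%N%:R) * eps k <= z.
    have C0 : 0 <= 2 + `|g|%N%:R :> R by rewrite addr_ge0.
    pose C := (2 + `|g|%N%:R) / z; have Cz : 0 <= C by rewrite divr_ge0 // ltW.
    exists (Num.bound C); apply: le_trans (ler_wpM2l C0 (eps_small _)) _.
    rewrite ler_pdivrMr ?exprn_gt0 // mulrC -ler_pdivrMr //.
    apply: ltW; apply: lt_trans (archi_boundP Cz) _.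
    by rewrite -natrX ltr_nat ltn_expl.
  apply: (@le_trans _ _ (mu (~` same g k))).
    apply: le_measure; rewrite ?inE //.
      by apply: measurableC; exact: measurable_same_column.
    by apply: subsetC; exact: bigcup_sup.
  by apply: le_trans (same_column_eps g k) _; rewrite lee_fin.
apply/negligibleP; first by apply: measurableC; exact: measurable_settled.
rewrite settledE setC_bigcap; apply: negligible_bigcup => n.
by rewrite setCI; apply: negligibleU; apply/negligibleP => //; exact: U0.
Qed.

(** Compare both [x + g] and [x + g + h] with [x], at a stage late enough. *)
Lemma settled_translate g x : settled x -> settled (a g x).
Proof.
move=> cx h; have [k1 [x1 x2 x3]] := cx g; have [k2 [_ y2 y3]] := cx (h + g).
exists (maxn k1 k2); have k1k := leq_maxl k1 k2; have k2k := leq_maxr k1 k2.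
split; first exact: linkable_from_le k1k _ x2.
  by rewrite -actD; exact: linkable_from_le k2k _ y2.
rewrite (chart_translate HX (chart_range_le HX k1k x3)).
by have := chart_range_le HX k2k y3; lia.
Qed.

End recurrence.

(** * Passing to the partner preserves the measure *)

Section measure_preserving.
Context (R : realType) d1 (X : measurableType d1) (mu : probability X R)
  (a : free_pmp_action mu) (N : nat -> nat) (c : nat -> X -> nat)
  (HX : chart a N c).
Context d2 (Y : measurableType d2) (nu : probability Y R)
  (b : free_pmp_action nu) (M : nat -> nat)
  (e : nat -> Y -> nat) (HY : chart b M e).
Variables (Q : nat -> nat -> nat -> Prop) (D : nat -> nat).
Hypothesis HQ : matching N M Q D.
Hypothesis Q_surj : forall k j, (j < M k)%N -> exists i, Q k i j.
Hypothesis Q_ext : forall k q i j, Q k i j -> (q * N k + i < N k.+1)%N ->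
  exists q', Q k.+1 (q * N k + i) (q' * M k + j).
Variable eps : nat -> R.
Hypothesis MN_eps : forall k, 1 - eps k <= (M k)%:R / (N k)%:R.
Hypothesis eps_small : forall k, eps k <= (2 ^+ k)^-1.

Local Notation G := (linkable_from c e Q).
Local Notation phi := (partner c e Q).
Local Notation L := (linkable c e Q).

Lemma matched_linkable_from k x j : Q k (c k x) j -> G k x.
Proof.
move=> xj; rewrite (linkable_fromE c HY HQ) => l /= kl.
have [i xi] : exists i, Q l (c l x) i.
  move: kl => /subnKC <-; elim: (l - k)%N => [|m [i xi]].
    by exists j; rewrite addn0.
  rewrite addnS; have [q xq _] := chart_col HX (k + m) x.
  have [|q' Qq'] := @Q_ext _ q _ _ xi; first by rewrite -xq (chart_lt HX).
  by rewrite xq; eexists; exact: Qq'.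
have [q xq _] := chart_col HX l x.
have [|q' Qq'] := @Q_ext _ q _ _ xi; first by rewrite -xq (chart_lt HX).
exists i, (q' * M l + i)%N; split=> //; first by rewrite xq.
by rewrite modnMDl modn_small //; have [] := match_lt HQ xi.
Qed.

(** A match occupies one level in each tower, so a set of matched levels of the
    second tower weighs the same number of levels in the first. *)
Lemma matched_measure k (P : pred nat) :
  exists2 E, measurable E /\ mu E = ((count P (iota 0 (M k)))%:R / (N k)%:R)%:E
    & forall x, E x -> exists2 j, Q k (c k x) j & P j.
Proof.
have invP j : exists i, (j < M k)%N -> Q k i j.
  by case: (ltnP j (M k)) => [/Q_surj[i]|_]; [exists i|exists 0%N].
have {invP} [inv invP] := choice invP.
pose s := [seq inv j | j <- iota 0 (M k) & P j].
have sP i : i \in s -> exists2 j, Q k i j & P j.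
  case/mapP => j; rewrite mem_filter mem_iota => /andP[Pj /= jM] ->.
  by exists j => //; exact: invP.
exists [set x | c k x \in s]; last by move=> x /sP.
split; first exact: (measurable_chart HX k [set i | i \in s]).
rewrite (chart_measure HX) ?size_map ?size_filter //.
  rewrite map_inj_in_uniq ?filter_uniq ?iota_uniq // => j j'.
  rewrite !mem_filter !mem_iota => /andP[_ /= jM] /andP[_ /= jM'] ij.
  by apply: (match_fun HQ (invP _ jM)); rewrite ij; exact: invP.
by move=> i /sP[j /(match_lt HQ)[iN _] _]; rewrite mem_iota.
Qed.

Lemma linkable_from_eps k : (mu (~` G k) <= (eps k)%:E)%E.
Proof.
have mG := measurable_linkable_from HX HY HQ k.
have [E [mE muE] EP] := matched_measure k xpredT.
rewrite probability_setC // leeBlDl; last by rewrite fin_num_measure.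
apply: (@le_trans _ _ (mu E + (eps k)%:E)%E).
  rewrite muE count_predT size_iota -EFinD lee_fin.
  by rewrite -lerBlDr.
rewrite leeD2r // le_measure ?inE // => x /EP[j xj _];
  exact: matched_linkable_from xj.
Qed.

Let mphi : measurable_fun L phi := measurable_partner HX HY HQ.
Let mL : measurable L := measurable_linkable HX HY HQ.

Let lower k (P : pred nat) :
  (nu [set y | P (e k y)] <= mu (L `&` phi @^-1` [set y | P (e k y)]))%E.
Proof.
have mP : measurable (L `&` phi @^-1` [set y | P (e k y)]).
  by apply: mphi => //; exact: (measurable_chart HY k [set i | P i]).
have fin : nu [set y | P (e k y)] \is a fin_num.
  by apply: fin_num_measure; exact: (measurable_chart HY k [set i | P i]).
apply/lee_addgt0Pr => z z0.
have [l kl lz] : exists2 l, (k <= l)%N & eps l <= z.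
  have Cz : 0 <= z^-1 by rewrite invr_ge0 ltW.
  (* [eps l <= 2^-l < 1 / l <= z] for [l] at least [1 / z]. *)
  exists (maxn k (Num.bound z^-1)); first exact: leq_maxl.
  apply: le_trans (eps_small _) _;
    rewrite -[leRHS]invrK lef_pV2 ?posrE ?invr_gt0 ?exprn_gt0 //.
  apply: ltW; apply: lt_le_trans (archi_boundP Cz) _.
  rewrite -natrX ler_nat; apply: leq_trans (leq_maxr k _) _; apply: ltnW;
    exact: ltn_expl.
have [E [mE muE] EP] := matched_measure l (fun j => P (j %% M k)%N).
apply: (@le_trans _ _ (mu E + z%:E)%E); last first.
  rewrite leeD2r // le_measure ?inE // => x /EP[j xj Pj].
  have xl := matched_linkable_from xj; split; first by exists l.
  have /(_ l (leqnn _)) xy := partner_linked HY HQ xl.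
  by rewrite /= -(chart_mod_le HY _ kl) -(match_fun HQ xj xy).
rewrite muE.
have -> : [set y | P (e k y)] = [set y | P (e l y %% M k)%N].
  by apply/seteqP; split=> y /=; rewrite (chart_mod_le HY).
rewrite (chart_measureP HY l (fun j => P (j %% M k)%N)) -EFinD lee_fin.
set n := count _ _.
have M0 : 0 < (M l)%:R :> R by rewrite ltr0n (chart_N_gt0 HY).
have N0 : 0 < (N l)%:R :> R by rewrite ltr0n (chart_N_gt0 HX).
have -> : n%:R / (N l)%:R = n%:R / (M l)%:R * ((M l)%:R / (N l)%:R) :> R.
  by field; rewrite !gt_eqF.
have r0 : 0 <= n%:R / (M l)%:R :> R by rewrite divr_ge0.
have r1 : n%:R / (M l)%:R <= 1 :> R.
  by rewrite ler_pdivrMr // mul1r ler_nat (leq_trans (count_size _ _))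
    ?size_iota.
have ept := MN_eps l; set ep := eps l in lz ept *;
  set t := (M l)%:R / _ in ept *.
set r := n%:R / _ in r0 r1 *.
have : r * (1 - ep) <= r * t by apply: ler_wpM2l.
case: (leP 0 ep) => [ep0|ep0]; last nra.
have : r * ep <= ep by rewrite ler_piMl.
lra.
Qed.

Lemma linkable_full : mu L = 1%E.
Proof.
apply/eqP; rewrite eq_le probability_le1 //=.
have := lower 0 xpredT; have -> : [set y | xpredT (e 0 y)] = setT
  by exact/seteqP.
by rewrite preimage_setT setIT probability_setT.
Qed.

(** At stage [l] a cylinder of [Y] of the form [P (e k y)] is made of matched
    levels only, so the set of points whose partner lies in it has measure at
    least [M l / N l] times its own, and the ratio tends to 1.  The same
    inequality for the complement forces equality on cylinders, which generate
    the Borel sets. *)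
Lemma partner_preserving B : measurable B -> mu (L `&` phi @^-1` B) = nu B.
Proof.
have mphiT : measurable_fun setT phi.
  rewrite -(setUv L) measurable_funU //; last exact: measurableC.
  split=> //; apply: (eq_measurable_fun (cst point));
    last exact: measurable_cst.
  move=> x; rewrite inE => nx /=; rewrite /partner xgetPN // => y [k xy].
  by apply: nx; exists k => //; exists y.
have mpre (B' : set Y) : measurable B' -> measurable (phi @^-1` B').
  by move=> mB; rewrite -[X in measurable X]setTI; exact: mphiT.
have muLc : mu (~` L) = 0%E by rewrite probability_setC // linkable_full subee.
have muL (B' : set Y) : measurable B' -> mu (L `&` phi @^-1` B') = mu
  (phi @^-1` B').
  move=> /mpre mB; rewrite [RHS](measureDI mu _ mL) // setIC.
  rewrite (@subset_measure0 _ _ _ mu (phi @^-1` B' `\` L) (~` L)) ?add0e //.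
  - exact: measurableD.
  - exact: measurableC.
move=> mB; rewrite muL //.
pose m1 : {measure set Y -> \bar R} :=
  measure_function_pushforward__canonical__measure_function_Measure mu mphiT.
rewrite -[LHS]/(m1 B).
pose cyl : set (set Y) := [set A | exists k i, A = [set y | e k y = i]].
have mcyl : measurable = <<s cyl >>.
  apply/seteqP; split; first exact: chart_gen HY.
  apply: smallest_sub; first exact: sigma_algebra_measurable.
  by move=> _ [k [i ->]]; exact: chart_meas HY _ _.
apply: (measure_unique cyl (fun i => [set y | e 0%N y = i]) mcyl) => //.
- move=> _ _ [k [i ->]] [l [j ->]].
  wlog kl : k i l j / (k <= l)%N => [W|].
    by case: (leqP k l) => [/W|/ltnW /W]; [|rewrite setIC]; exact.
  have [<-|ij] := eqVneq (j %% M k)%N i.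
    exists l, j; apply/seteqP; split=> [y []|y /= ye] //; split=> //=.
    by rewrite -ye (chart_mod_le HY).
  (* No level is numbered [M k], so this cylinder is the empty set. *)
  exists k, (M k); apply/seteqP; split=> [y [/= ye yl]|y /= ye]; exfalso.
    by move: ij; rewrite -yl (chart_mod_le HY) // ye eqxx.
  by have := chart_lt HY k y; rewrite ye ltnn.
- by move=> i; exists 0%N, i.
- by apply/seteqP; split=> // y _; exists (e 0%N y).
- move=> _ [k [i ->]]; rewrite /m1 /= /pushforward.
  have mi := chart_meas HY k i.
  have lo (P : pred nat) : (nu [set y | P (e k y)] <= mu
    (phi @^-1` [set y | P (e k y)]))%E.
    by rewrite -muL ?lower //; exact: (measurable_chart HY k [set i | P i]).
  apply/eqP; rewrite eq_le; apply/andP; split; last first.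
    by have := lo (pred1 i); congr (nu _ <= mu _)%E; apply/seteqP;
      split=> y /= /eqP.
  have := lo (predC1 i).
  have -> : [set y | predC1 i (e k y)] = ~` [set y | e k y = i].
    by apply/seteqP; split=> y /= /eqP.
  rewrite -preimage_setC !probability_setC //; last exact: mpre.
  have f1 : nu [set y | e k y = i] \is a fin_num by exact: fin_num_measure.
  have f2 : mu (phi @^-1` [set y | e k y = i]) \is a fin_num.
    by apply: fin_num_measure; exact: mpre.
  by rewrite -(fineK f1) -(fineK f2) -!EFinB !lee_fin lerD2l lerN2.
- by move=> k; rewrite /m1 /= /pushforward (le_lt_trans (probability_le1 _ _))
    ?ltry //; apply: mpre; exact: chart_meas HY _ _.
Qed.

End measure_preserving.

(** * One half of the orbit equivalence *)

(** The domain of the orbit equivalence: the partner must be settled as well, so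
    that this set and its counterpart in [Y] correspond to each other and are
    both invariant. *)
Definition jointly_settled (X Y : Type) (c : nat -> X -> nat)
  (e : nat -> Y -> nat)
    (Q : nat -> nat -> nat -> Prop) (cX : set X) (cY : set Y) : set X :=
  [set x | cX x /\ exists y k, linked c e Q k x y /\ cY y].

Section half.
Context (R : realType) d1 (X : measurableType d1) (mu : probability X R)
  (a : free_pmp_action mu) (N : nat -> nat) (c : nat -> X -> nat)
  (HX : chart a N c).
Context d2 (Y : measurableType d2) (nu : probability Y R)
  (b : free_pmp_action nu) (M : nat -> nat)
  (e : nat -> Y -> nat) (HY : chart b M e).
Variables (Q : nat -> nat -> nat -> Prop) (D : nat -> nat).
Hypothesis HQ : matching N M Q D.

Local Notation QT := (transpose Q).
Let HQT : matching M N QT D := matching_sym HQ.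

Local Notation L := (linkable c e Q).
Local Notation phi := (partner c e Q).
Local Notation psi := (partner e c QT).
Local Notation settledX := (settled a N c e Q).
Local Notation settledY := (settled b M e c QT).
Local Notation X0 := (jointly_settled c e Q settledX settledY).
Local Notation Y0 := (jointly_settled e c QT settledY settledX).

Lemma jointly_settledE : X0 = settledX `&` (L `&` phi @^-1` settledY).
Proof.
apply/seteqP; split=> [x [xc [y [k [xy yc]]]]|x [xc [[k _ [y xy]] yc]]].
  split=> //; split; first by exists k => //; exists y.
  by rewrite /= (partnerE HY HQ xy).
split=> //; exists y, k; split=> //.
by rewrite /= (partnerE HY HQ xy) in yc.
Qed.

Lemma measurable_jointly_settled : measurable X0.
Proof.
have mcY := measurable_settled HY HX HQT.
rewrite jointly_settledE; apply: measurableI;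
  first by apply: (measurable_settled HX HY HQ).
exact: (measurable_partner HX HY HQ) (measurable_linkable HX HY HQ) _ mcY.
Qed.

Lemma jointly_settled_partner x : X0 x -> Y0 (phi x) /\ psi (phi x) = x.
Proof.
move=> [xc [y [k [xy yc]]]]; rewrite (partnerE HY HQ xy).
split; first by split=> //; exists x, k.
by apply: (partnerE HX HQT (k := k)) => l kl; exact: xy.
Qed.

Lemma jointly_settled_orbit g x : X0 x ->
  X0 (a g x) /\ exists s, phi (a g x) = b s (phi x).
Proof.
move=> [xc [y [k [xy yc]]]]; have [l] := xc g.
move=> /(same_column_le HX (leq_maxl l k)); set m := maxn l k.
move=> [_ [y' xy'] r]; have {}xy := linked_le (leq_maxr l k) xy.
have [e' _] := linked_translate HX HY HQ xy xy' r.
split; last first.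
  by eexists; rewrite (partnerE HY HQ xy) (partnerE HY HQ xy'); exact: e'.
split; first exact: (settled_translate HX g xc).
exists y', m; split=> //; rewrite e'; exact: (settled_translate HY _ yc).
Qed.

Lemma jointly_settled_invariant g : a g @` X0 = X0.
Proof.
apply/seteqP; split=> [_ [x xX <-]|x xX];
  first by case: (jointly_settled_orbit g xX).
exists (a (- g) x); first by case: (jointly_settled_orbit (- g) xX).
by rewrite -actD subrr act0.
Qed.

Hypothesis preserving : forall B, measurable B -> mu (L `&` phi @^-1` B) = nu B.
Hypothesis conullX : mu (~` settledX) = 0%E.
Hypothesis conullY : nu (~` settledY) = 0%E.

Lemma jointly_settled_conull : mu (~` X0) = 0%E.
Proof.
have mcX := measurable_settled HX HY HQ.
have mcY := measurable_settled HY HX HQT.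
have mL : measurable (L `&` phi @^-1` settledY).
  exact: (measurable_partner HX HY HQ) (measurable_linkable HX HY HQ) _ mcY.
have nuY : nu settledY = 1%E.
  by rewrite -[settledY]setCK probability_setC ?conullY ?sube0 //;
    exact: measurableC.
have muL : mu (~` (L `&` phi @^-1` settledY)) = 0%E.
  by rewrite probability_setC // preserving // nuY subee.
apply/negligibleP; first by apply: measurableC;
  exact: measurable_jointly_settled.
rewrite jointly_settledE setCI; apply: negligibleU; apply/negligibleP => //;
  exact: measurableC.
Qed.

Section shannon.
Hypothesis free_b : forall s y, b s y = y -> s = 0.
Variable eps : nat -> R.
Hypothesis linkable_from_eps : forall k,
  (mu (~` linkable_from c e Q k) <= (eps k)%:E)%E.
Hypothesis N_eps : forall k, (N k)%:R^-1 <= eps k.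
Hypothesis eps_decay : forall B : nat, exists2 C : R, 0 <= C &
  forall k, eps k * ln (2 + 2 * (B + 2 * D k.+1)%:R) <= C / 2 ^+ k.
Hypothesis D_large : forall k, (k <= D k)%N.

Variable kappa : int -> X -> int.
Hypothesis kappaP : cocycle_of a b X0 phi kappa.

Local Notation same := (same_column a N c e Q).

(** Freeness identifies the cocycle with the difference of matched levels. *)
Lemma cocycle_column g k x : X0 x -> same g k x ->
  exists j j', [/\ Q k (c k x) j, Q k (c k (a g x)) j',
    kappa g x = j'%:Z - j%:Z & (`|kappa g x| <= `|g| + 2 * D k)%N].
Proof.
move=> xX [[y xy] [y' xy'] r].
have [e' le] := linked_translate HX HY HQ xy xy' r.
have := kappaP g xX; rewrite (partnerE HY HQ xy) (partnerE HY HQ xy') e'.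
set s := _ - _ in e' le * => ks.
have -> : kappa g x = s.
  apply/eqP; rewrite -subr_eq0; apply/eqP/(free_b (y := y)).
  by rewrite addrC actD ks -actD addrC subrr act0.
by exists (e k y), (e k y'); split=> //; [exact: xy|exact: xy'].
Qed.

Lemma measurable_cocycle g s : measurable (cocycle_partition X0 kappa g s).
Proof.
pose P k := [set i : nat | exists j j',
  [/\ Q k i j, Q k `|(i%:Z + g)%R|%N j' & s = j'%:Z - j%:Z]].
have -> : cocycle_partition X0 kappa g s =
    X0 `&` \bigcup_k (same g k `&` [set x | P k (c k x)]).
  apply/seteqP; split=> [x [xX ks]|x [xX [k _ [xk [j [j' [Qj Qj' ->]]]]]]].
    split=> //; have [cx _] := xX; have [k xk] := cx g; exists k => //;
      split=> //.
    have [j [j' [Qj Qj' kE _]]] := cocycle_column xX xk.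
    exists j, j'; split=> //; last by rewrite -ks.
    by have [_ _ r] := xk; rewrite -(chart_translate HX r).
  split=> //; have [i [i' [Qi Qi' -> _]]] := cocycle_column xX xk.
  have [_ _ r] := xk; rewrite -(chart_translate HX r) in Qj'.
  by rewrite (match_fun HQ Qi Qj) (match_fun HQ Qi' Qj').
apply: measurableI; first exact: measurable_jointly_settled.
apply: bigcupT_measurable => k; apply: measurableI.
  exact: (measurable_same_column HX HY HQ).
exact: (measurable_chart HX k (P k)).
Qed.

(** The cocycle is at most [`|g| + 2 * D k] outside a set of measure
    [(2 + `|g|) * eps k]. *)
Lemma cocycle_shannon : shannon_cocycle mu X0 kappa.
Proof.
move=> g; split; first exact: measurable_cocycle.
have [C C0 decay] := eps_decay `|g|%N.
have c0 : 0 <= 2 + `|g|%N%:R :> R by rewrite addr_ge0.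
apply: (@entropy_finite R _ _ mu _ (fun k => `|g| + 2 * D k)%N
  (fun k => (2 + `|g|%N%:R) * eps k) ((2 + `|g|%N%:R) * C)).
- exact: measurable_cocycle.
- by apply/trivIsetP => i j _ _ ij; apply/seteqP; split=> // x [[_ ki] [_ kj]];
    rewrite -ki kj eqxx in ij.
- exact: mulr_ge0.
- move=> i; exists i => k ik; have := D_large k; lia.
- move=> k; exists (~` same g k); first split.
  + by apply: measurableC; exact: (measurable_same_column HX HY HQ).
  + exact: (same_column_eps HX HY HQ linkable_from_eps N_eps).
  + move=> s sk x [xX ks] xk; have [j [j' [_ _ _]]] := cocycle_column xX xk.
    by rewrite ks leqNgt sk.
- by move=> k; rewrite -mulrA -[leRHS]mulrA ler_wpM2l.
Qed.

End shannon.
End half.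

(** * Matchings give Shannon orbit equivalences *)

Section coupling.
Context (R : realType) d1 (X : measurableType d1) (mu : probability X R)
  (a : free_pmp_action mu) (N : nat -> nat) (c : nat -> X -> nat)
  (HX : chart a N c).
Context d2 (Y : measurableType d2) (nu : probability Y R)
  (b : free_pmp_action nu) (M : nat -> nat)
  (e : nat -> Y -> nat) (HY : chart b M e).
Variables (Q : nat -> nat -> nat -> Prop) (D : nat -> nat).
Hypothesis HQ : matching N M Q D.
Hypothesis Q_surj : forall k j, (j < M k)%N -> exists i, Q k i j.
Hypothesis Q_ext : forall k q i j, Q k i j -> (q * N k + i < N k.+1)%N ->
  exists q', Q k.+1 (q * N k + i) (q' * M k + j).
Hypothesis free_a : forall s x, a s x = x -> s = 0.
Hypothesis free_b : forall s y, b s y = y -> s = 0.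
Variable eps : nat -> R.
Hypothesis MN_eps : forall k, 1 - eps k <= (M k)%:R / (N k)%:R.
Hypothesis N_eps : forall k, (N k)%:R^-1 <= eps k.
Hypothesis M_eps : forall k, (M k)%:R^-1 <= eps k.
Hypothesis eps_small : forall k, eps k <= (2 ^+ k)^-1.
Hypothesis eps_decay : forall B : nat, exists2 C : R, 0 <= C &
  forall k, eps k * ln (2 + 2 * (B + 2 * D k.+1)%:R) <= C / 2 ^+ k.
Hypothesis D_large : forall k, (k <= D k)%N.

Local Notation QT := (transpose Q).
Let HQT : matching M N QT D := matching_sym HQ.
Local Notation phi := (partner c e Q).
Local Notation psi := (partner e c QT).
Local Notation L := (linkable c e Q).
Local Notation L' := (linkable e c QT).
Local Notation settledX := (settled a N c e Q).
Local Notation settledY := (settled b M e c QT).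
Local Notation X0 := (jointly_settled c e Q settledX settledY).
Local Notation Y0 := (jointly_settled e c QT settledY settledX).

Let pres B : measurable B -> mu (L `&` phi @^-1` B) = nu B.
Proof. exact: (partner_preserving HX HY HQ Q_surj Q_ext MN_eps eps_small). Qed.

Let linkable_from_epsX k : (mu (~` linkable_from c e Q k) <= (eps k)%:E)%E.
Proof. exact: (linkable_from_eps HX HY HQ Q_surj Q_ext MN_eps). Qed.

(** A partner of a point linkable from stage [k] is linkable from stage [k]; as
    the partner map preserves the measure, the estimate carries over to [Y]. *)
Let linkable_from_epsY k : (nu (~` linkable_from e c QT k) <= (eps k)%:E)%E.
Proof.
apply: le_trans (linkable_from_epsX k).
have mGX := measurable_linkable_from HX HY HQ k.
have mGY := measurable_linkable_from HY HX HQT k.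
have mL := measurable_linkable HX HY HQ.
rewrite -pres; last exact: measurableC.
apply: le_measure; rewrite ?inE.
- by apply: (measurable_partner HX HY HQ) => //; exact: measurableC.
- exact: measurableC.
- move=> x [_ /= nG] [y xy]; apply: nG; rewrite (partnerE HY HQ xy).
  by exists x.
Qed.

Let pres' A : measurable A -> nu (L' `&` psi @^-1` A) = mu A.
Proof.
move=> mA; have mL := measurable_linkable HX HY HQ.
have mL' := measurable_linkable HY HX HQT.
have mB : measurable (L' `&` psi @^-1` A)
  by exact: (measurable_partner HY HX HQT).
have muL : mu (~` L) = 0%E.
  rewrite probability_setC //
    (linkable_full HX HY HQ Q_surj Q_ext MN_eps eps_small).
  by rewrite subee.
rewrite -pres // (measureDI mu mA mL).
rewrite (@subset_measure0 _ _ _ mu (A `\` L) (~` L)) ?add0e //; first last.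
- exact: measurableC.
- exact: measurableD.
congr (mu _); apply/seteqP; split=> x.
  move=> [[k _ [y xy]]]; rewrite /= (partnerE HY HQ xy) => -[_].
  by rewrite (partnerE HX HQT (k := k) (y := x)) // => Ax; split=> //;
    exists k => //; exists y.
move=> [Ax [k _ [y xy]]]; split; first by exists k => //; exists y.
rewrite /= (partnerE HY HQ xy); split; first by exists k => //; exists x.
by rewrite (partnerE HX HQT (k := k) (y := x)).
Qed.

Let conullX : mu (~` settledX) = 0%E.
Proof. exact: (settled_conull HX HY HQ linkable_from_epsX N_eps eps_small). Qed.

Let conullY : nu (~` settledY) = 0%E.
Proof. exact: (settled_conull HY HX HQT linkable_from_epsY M_eps eps_small).
  Qed.

(** The partner map is the orbit equivalence; everything that concerns its
    inverse is the corresponding fact for the transposed matching. *)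
Theorem matching_shannon_orbit_equivalent : shannon_orbit_equivalent a b.
Proof.
pose kappa g x := xget 0 [set s | b s (phi x) = phi (a g x)].
pose lambda h y := xget 0 [set s | a s (psi y) = psi (b h y)].
have kappaP : cocycle_of a b X0 phi kappa.
  move=> g x /(jointly_settled_orbit HX HY HQ g)[_ [s xs]].
  exact: (xgetPex 0 (ex_intro (fun s => b s (phi x) = phi (a g x)) s
    (esym xs))).
have lambdaP : cocycle_of b a Y0 psi lambda.
  move=> h y /(jointly_settled_orbit HY HX HQT h)[_ [s ys]].
  exact: (xgetPex 0 (ex_intro (fun s => a s (psi y) = psi (b h y)) s
    (esym ys))).
have mX0 := measurable_jointly_settled HX HY HQ.
have mY0 := measurable_jointly_settled HY HX HQT.
have X0Y0 x : X0 x -> Y0 (phi x) /\ psi (phi x) = x := @jointly_settled_partner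
  _ _ _ _ _ _ _ HX _ _ _ _ _ _ HY _ _ HQ x.
have Y0X0 y : Y0 y -> X0 (psi y) /\ phi (psi y) = y := @jointly_settled_partner
  _ _ _ _ _ _ _ HY _ _ _ _ _ _ HX _ _ HQT y.
have nullX0 : mu (~` X0) = 0%E
  by exact: (jointly_settled_conull HX HY HQ pres conullX conullY).
have nullY0 : nu (~` Y0) = 0%E
  by exact: (jointly_settled_conull HY HX HQT pres' conullY conullX).
have mL := measurable_linkable HX HY HQ.
have mL' := measurable_linkable HY HX HQT.
have X0L : X0 `<=` L by move=> x [_ [y [k [xy _]]]]; exists k => //; exists y.
have Y0L : Y0 `<=` L' by move=> x [_ [y [k [xy _]]]]; exists k => //; exists y.
exists X0, Y0, phi, psi, kappa, lambda; split=> //.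
- split.
  + split=> // g; exact: (jointly_settled_invariant HX HY HQ).
  + split=> // g; exact: (jointly_settled_invariant HY HX HQT).
  + split.
    * by move=> x /X0Y0[].
    * move=> x x'; rewrite !inE => /X0Y0[_ e1] /X0Y0[_ e2] e3.
      by rewrite -e1 -e2 e3.
    * by move=> y /Y0X0[]; exists (psi y).
  + by move=> x; rewrite inE => /X0Y0[].
  + exact: measurable_funS mL X0L (measurable_partner HX HY HQ).
  + exact: measurable_funS mL' Y0L (measurable_partner HY HX HQT).
  + move=> B mB; rewrite -pres //.
    have mLB : measurable (L `&` phi @^-1` B)
      by exact: (measurable_partner HX HY HQ).
    rewrite (measureDI mu mLB mX0).
    rewrite (@subset_measure0 _ _ _ mu ((L `&` phi @^-1` B) `\` X0) (~` X0))
      ?add0e //.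
      by congr (mu _); apply/seteqP; split=> x [xX xB];
        [split; [split; [exact: X0L|]|]|case: xX].
      exact: measurableD.
      exact: measurableC.
  + move=> x xX; apply/seteqP; split=> [_ [_ [g _ <-] <-]|_ [h _ <-]].
      by exists (kappa g x) => //; exact: kappaP.
    have [Yx px] := X0Y0 _ xX.
    exists (psi (b h (phi x))).
      by exists (lambda h (phi x)) => //; rewrite -lambdaP // px.
    by have [/Y0X0[]] := jointly_settled_orbit HY HX HQT h Yx.
- exact: (cocycle_shannon HX HY HQ free_b linkable_from_epsX N_eps eps_decay
    D_large kappaP).
- exact: (cocycle_shannon HY HX HQT free_a linkable_from_epsY M_eps eps_decay
    D_large lambdaP).
Qed.

End coupling.

(** * Rates of convergence *)

Section rate.
Context (R : realType) (N : nat -> nat).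
Hypothesis N0_ge4 : (4 <= N 0)%N.
Hypothesis N_growth : forall k, ((2 ^ k.+2 * k.+3 * N k) ^ 2 <= N k.+1)%N.

Local Notation M := (height N).

(** Small enough to be summable against [ln (N k)], large enough to dominate
    the relative gap and the inverse heights. *)
Definition rate (k : nat) : R := (2 ^+ k * Num.sqrt (N k)%:R)^-1.

Let s k : R := Num.sqrt (N k)%:R.

Let sN k : (N k)%:R = s k * s k.
Proof. by rewrite -expr2 sqr_sqrtr. Qed.

Let gap k : 2 * 2 ^+ k * ((N k)%:R - (M k)%:R) <= s k /\ 1 <= (N k)%:R
  - (M k)%:R :> R.
Proof.
have /andP[_ MN] := height_bounds N0_ge4 N_growth k.
have := gap_small N0_ge4 N_growth k.
rewrite -natrB ?(ltnW MN) //; split; last by rewrite ler1n subn_gt0.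
rewrite -exprS -natrX -natrM -(@ler_pXn2r _ 2) ?nnegrE ?sqrtr_ge0 //.
by rewrite sqr_sqrtr // -natrX ler_nat.
Qed.

Let two_le k : 1 <= 2 ^+ k :> R.
Proof. by rewrite exprn_ege1 // ler1n. Qed.

Lemma rate_gap k : 1 - rate k <= (M k)%:R / (N k)%:R.
Proof.
have [g1 g2] := gap k; have t1 := two_le k.
have s0 : 0 < s k by nra.
rewrite lerBlDr /rate -/(s k) sN.
move: (s k) (2 ^+ k) (M k)%:R (sN k) g1 g2 t1 s0 => u t m -> g1 g2 t1 u0.
have -> : m / (u * u) + (t * u)^-1 = 1 + (u - t * (u * u - m)) / (t * (u * u)).
  by field; rewrite !gt_eqF //; lra.
rewrite lerDl divr_ge0 //; nra.
Qed.

Lemma rate_N k : (N k)%:R^-1 <= rate k.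
Proof.
have [g1 g2] := gap k; have t1 := two_le k.
have s0 : 0 < s k by nra.
have st : 2 ^+ k <= s k by nra.
by rewrite /rate -/(s k) sN lef_pV2 ?posrE ?mulr_gt0 //; nra.
Qed.

Lemma rate_M k : (M k)%:R^-1 <= rate k.
Proof.
have [g1 g2] := gap k; have t1 := two_le k.
have s0 : 0 < s k by nra.
have st : 2 * 2 ^+ k <= s k by nra.
have /andP[M0 _] := height_bounds N0_ge4 N_growth k.
rewrite /rate -/(s k) lef_pV2 ?posrE ?mulr_gt0 ?ltr0n ?exprn_gt0 //.
have := sN k; nra.
Qed.

Lemma rate_small k : rate k <= (2 ^+ k)^-1.
Proof.
have [g1 g2] := gap k; have t1 := two_le k.
have s1 : 1 <= s k by nra.
by rewrite /rate -/(s k) lef_pV2 ?posrE ?mulr_gt0 ?exprn_gt0 //; nra.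
Qed.

Lemma rate_decay (B : nat) : exists2 C : R, 0 <= C &
  forall k, rate k * ln (2 + 2 * (B + 2 * displacement N k.+1)%:R) <= C /
    2 ^+ k.
Proof.
(* As [displacement N k.+1 <= 5 * s k ^+ 6], the argument of [ln] is at most
   [(22 + 2 * B) * s k ^+ 6], and [ln x <= x] applies to each of the factors. *)
exists (28 + 2 * B%:R) => [|k]; first by rewrite addr_ge0 // mulr_ge0.
have [g1 g2] := gap k; have t1 := two_le k.
have s1 : 1 <= s k by nra.
have s0 : 0 < s k by lra.
have B0 : 0 <= B%:R :> R by [].
have le : 2 + 2 * (B + 2 * displacement N k.+1)%:R <= (22 + 2 * B%:R) * s k
  ^+ 6.
  have dle : (displacement N k.+1)%:R <= 5 * s k ^+ 6 :> R.
    apply: (@le_trans _ _ (5 * N k ^ 3)%:R).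
      by rewrite ler_nat; exact: (displacement_le N0_ge4 N_growth).
    by rewrite natrM natrX sN -expr2 -exprM.
  have p6 : 1 <= s k ^+ 6 by exact: exprn_ege1.
  rewrite natrD natrM; move: (s k ^+ 6) (displacement _ _)%:R dle p6 => v w;
    nra.
have arg0 : 0 < 2 + 2 * (B + 2 * displacement N k.+1)%:R :> R.
  by rewrite ltr_wpDr // mulr_ge0.
have lnle : ln (2 + 2 * (B + 2 * displacement N k.+1)%:R) <= (28 + 2 * B%:R) * s
  k :> R.
  have c0 : 0 < 22 + 2 * B%:R :> R by lra.
  apply: (@le_trans _ _ (ln ((22 + 2 * B%:R) * s k ^+ 6))).
    by rewrite ler_ln ?posrE // mulr_gt0 // exprn_gt0.
  rewrite lnM ?posrE ?exprn_gt0 // lnXn // -(mulr_natr (ln (s k))).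
  have l1 := ln_sublinear c0; have l2 := ln_sublinear s0.
  have l3 : (22 + 2 * B%:R) * 1 <= (22 + 2 * B%:R) * s k by rewrite ler_pM2l.
  lra.
rewrite /rate -/(s k) invfM -mulrA [leRHS]mulrC ler_pM2l ?invr_gt0
  ?exprn_gt0 //.
by rewrite mulrC ler_pdivrMr.
Qed.

End rate.

(** * Shannon orbit equivalence of odometers *)

Theorem theorem3 (R : realType) (q : supernatural) (n m : nat -> nat)
  (qinf : infinitely_many_factors q)
  (nq : factor_sequence q n)
  (mu : probability (odometer n) R)
  (mu_inv : invariant_measure mu (translate nq.1))
  (mP : factor_sequence universal_supernatural m)
  (nu : probability (odometer m) R)
  (nu_inv : invariant_measure nu (translate mP.1)) :
  shannon_orbit_equivalent
    (odometer_action qinf mu_inv)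
    (odometer_action universal_infinitely_many nu_inv).
Proof.
have [J [N0 Jge Jle growth]] := fast_subsequence qinf nq.
pose N k := modulus n (J k).
have N_dvd k : (N k %| N k.+1)%N by apply: modulus_dvd.
have NJ k : (N k %| modulus n (J k))%N by [].
have N_cofinal j : exists k, (modulus n j %| N k)%N.
  by exists j; apply: modulus_dvd.
have N_pos k : (0 < N k)%N by apply: modulus_gt0 nq.1 _.
have hX := coord_chart nq.1 N_pos N_dvd NJ N_cofinal.
pose M := height N.
have bounds k := height_bounds N0 growth k.
have M_pos k : (0 < M k)%N by have /andP[] := bounds k.
have [J' MJ'] := choice (fun k => dvdn_modulus_universal mP (M_pos k)).
have M_cofinal j : exists k, (modulus m j %| M k)%N.
  exists (modulus m j); apply: dvdn_trans (height_fact N _).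
  by apply: dvdn_fact; rewrite modulus_gt0 ?leqnn //; exact: mP.1.
have hY := coord_chart mP.1 M_pos (height_dvd_succ N) MJ' M_cofinal.
apply: (matching_shannon_orbit_equivalent
  (a := odometer_action qinf mu_inv)
  (b := odometer_action universal_infinitely_many nu_inv) hX hY
    (matching_matched N0 N_dvd growth) _ _ _ _
  (rate_gap R N0 growth) (rate_N R N0 growth) (rate_M R N0 growth)
  (rate_small R N0 growth) (rate_decay R N0 growth)).
- move=> k j jM; have /andP[_ MN] := bounds k.
  have [i iN ij] := stage_perm_surj N0 N_dvd growth (ltn_trans jM MN).
  by exists i.
- by move=> k c i j ij cN; exact: (matched_ext N0 N_dvd growth cN ij).
- by move=> s x; exact: (translate_free qinf nq.2).
- by move=> s x; exact: (translate_free universal_infinitely_many mP.2).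
- exact: (displacement_ge N0 growth).
Qed.
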